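(* Let $S$ be a finite set of closed line segments in the plane such that any two segments of $S$ intersect in at most one point, and such that the arrangement graph $G(S)$ is triangle-free (has no cycle of length 3). Given $G(S)$, one can compute in $O(m)$ time, where $m$ is the number of edges of $G(S)$, a set of points hitting every segment of $S$ whose cardinality is at most $3$ times the minimum cardinality of such a set.
   Context: The arrangement graph $G(S)$ has as vertices all endpoints of segments of $S$ and all intersection points of pairs of segments of $S$, and has an edge between each pair of vertices that appear consecutively along some segment of $S$. A set of points hits a segment if the segment contains at least one of the points. *)

(* Defs.v *)
From HB Require Import structures.
From mathcomp Require Import all_boot all_order all_algebra.
From mathcomp Require Import boolp reals.
Set Implicit Arguments. Unset Strict Implicit. Unset Printing Implicit Defensive.
Import Order.TTheory GRing.Theory Num.Theory.
Local Open Scope ring_scope.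

Section Geometry.
Variable R : realType.

Definition point := (R * R)%type.
Definition segment := (point * point)%type.

Definition seg_param (s : segment) (t : R) : point :=
  (s.1.1 + t * (s.2.1 - s.1.1), s.1.2 + t * (s.2.2 - s.1.2)).

Definition on_seg (x : point) (s : segment) : Prop :=
  exists t : R, 0 <= t <= 1 /\ x = seg_param s t.

Definition seg_before (s : segment) (x y : point) : Prop :=
  exists t u : R, [/\ 0 <= t, t < u, u <= 1, x = seg_param s t & y = seg_param s u].

Variable n : nat.
Variable S : 'I_n -> segment.

Definition arr_vertex (x : point) : Prop :=
  (exists i, x = (S i).1 \/ x = (S i).2) \/
  (exists i j, i != j /\ on_seg x (S i) /\ on_seg x (S j)).

Definition arr_edge (x y : point) : Prop :=
  [/\ x <> y, arr_vertex x, arr_vertex y &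
   exists i, [/\ on_seg x (S i), on_seg y (S i) &
     ~ (exists z, [/\ arr_vertex z, z <> x, z <> y & on_seg z (x, y)])]].

Definition arr_triangle_free : Prop :=
  forall x y z, arr_edge x y -> arr_edge y z -> arr_edge z x -> False.

Definition pairwise_at_most_one_point : Prop :=
  forall i j, i != j -> forall x y,
    on_seg x (S i) -> on_seg x (S j) -> on_seg y (S i) -> on_seg y (S j) -> x = y.

Definition segs_nondegenerate : Prop := forall i, (S i).1 != (S i).2.

Definition hits_all (P : seq point) : Prop :=
  forall i, exists x, x \in P /\ on_seg x (S i).

(* Encoding of G(S) given to the algorithm: vertices are numbered
   0..N-1 (coordinates c), and for each segment i, L i lists the vertices
   lying on it, in order along the segment. *)
Definition valid_encoding (N : nat) (c : 'I_N -> point) (L : 'I_n -> seq 'I_N)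
  : Prop :=
  [/\ injective c,
      (forall x, arr_vertex x <-> exists v, c v = x) &
      forall i, [/\ forall v, v \in L i <-> on_seg (c v) (S i),
                    uniq (L i) &
                    sorted (fun a b => `[< seg_before (S i) (c a) (c b) >]) (L i)]].

Definition arr_num_edges (N : nat) (c : 'I_N -> point) : nat :=
  #|[set p : 'I_N * 'I_N | (p.1 < p.2)%N && `[< arr_edge (c p.1) (c p.2) >]]|.

End Geometry.

(* Unit-cost random access machine (registers and memory hold nats).   *)
Inductive instr : Type :=
| IConst of nat & nat
| IAdd of nat & nat & nat
| ISub of nat & nat & nat      (* ISub d a b   : r[d] := r[a] - r[b] (truncated) *)
| ILoad of nat & nat
| IStore of nat & nat
| IJz of nat & nat
| IJmp of nat
| IHalt.

Record config := Config { cf_pc : nat; cf_regs : nat -> nat; cf_mem : nat -> nat }.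

Definition upd (f : nat -> nat) (a v : nat) : nat -> nat :=
  fun b => if b == a then v else f b.

Definition halted (prog : seq instr) (cf : config) : bool :=
  match nth IHalt prog (cf_pc cf) with IHalt => true | _ => false end.

Definition step (prog : seq instr) (cf : config) : config :=
  let: Config p r m := cf in
  match nth IHalt prog p with
  | IConst d k => Config p.+1 (upd r d k) m
  | IAdd d a b => Config p.+1 (upd r d (r a + r b)%N) m
  | ISub d a b => Config p.+1 (upd r d (r a - r b)%N) m
  | ILoad d a => Config p.+1 (upd r d (m (r a))) m
  | IStore a s => Config p.+1 r (upd m (r a) (r s))
  | IJz q l => Config (if r q == 0%N then l else p.+1) r m
  | IJmp l => Config l r m
  | IHalt => cf
  end.

Fixpoint run (prog : seq instr) (t : nat) (cf : config) : config :=
  if t is t'.+1 then run prog t' (step prog cf) else cf.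

Definition encode (n N : nat) (L : 'I_n -> seq 'I_N) : seq nat :=
  N :: n :: flatten [seq size (L i) :: map val (L i) | i <- enum 'I_n].

Definition init_config (input : seq nat) : config :=
  Config 0 (fun _ => 0%N) (fun a => nth 0%N input a).

(* output layout: mem[0] = K, mem[1..K] = indices of the chosen vertices *)
Definition output (m : nat -> nat) : seq nat := [seq m k.+1 | k <- iota 0 (m 0%N)].

(* Main.v *)
Require Import Defs.
From HB Require Import structures.
From mathcomp Require Import all_boot all_order all_algebra.
From mathcomp Require Import boolp reals.
From mathcomp Require Import zify lra ring.
Set Implicit Arguments. Unset Strict Implicit. Unset Printing Implicit Defensive.

(** The algorithm is a greedy with thresholds: for j = 4, 2, 1 in turn, scan the
    vertices once and pick every vertex that lies on at least j segments not hit so far.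

    Let d(v) be the number of segments through v and W = { v | d(v) >= 2 }. The
    subgraph of G(S) induced on W has at least sum_(v in W) d(v) - n edges and, being
    plane and triangle-free, at most 2 |W|; hence sum_(v in W) (d(v) - 2) <= n.
    Let P be a hitting set of size k, and let a (resp. y) be the number of picks of the
    first pass inside (resp. outside) P. Since n <= sum_(x in P) d(x), the picks
    outside P satisfy 2 y <= sum (d - 2) <= 2 k. The segments left by the first pass are
    hit by the k - a other points of P, at most 3 per point, and those left by the
    second pass at most 1 per point. If the last two passes make x2 and x1 picks then
    2 x2 + x1 <= 3 (k - a) and x1 <= k - a, so a + y + x2 + x1 <= 3 k.

    The bound E <= 2 V for a triangle-free straight-line graph is proved by a sweep
    along a generic direction. The 2 E sides of the edges and a point at infinity are
    classified by the relation "bound a common cell of some slab". It is generated by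
    V + E pairs, r + 1 for each vertex with r edges to its right, so there are at least
    E - V bounded classes; and in the absence of triangles each bounded class
    contains at least 4 sides, whence 4 (E - V) <= 2 E. *)

(** * Structured programs for the random access machine *)

Inductive cmd :=
| Block of seq instr
| Seq of cmd & cmd
| While of nat & cmd
| When of nat & cmd.

Notation "c1 ;; c2" := (Seq c1 c2) (at level 60, right associativity).

Definition store := ((nat -> nat) * (nat -> nat))%type.

Definition plain (i : instr) : bool :=
  match i with IJz _ _ | IJmp _ | IHalt => false | _ => true end.

Definition effect (s : store) (i : instr) : store :=
  let: (r, m) := s in
  match i with
  | IConst d k => (upd r d k, m)
  | IAdd d a b => (upd r d (r a + r b), m)
  | ISub d a b => (upd r d (r a - r b), m)
  | ILoad d a => (upd r d (m (r a)), m)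
  | IStore a b => (r, upd m (r a) (r b))
  | _ => s
  end.

(** The number counts machine steps. A completed loop round pays one step for the [IJz] test and one
    for the [IJmp] back; leaving the loop pays only for the test. *)
Inductive exec : cmd -> store -> nat -> store -> Prop :=
| ExecBlock b s : all plain b -> exec (Block b) s (size b) (foldl effect s b)
| ExecSeq c1 c2 s t1 s1 t2 s2 :
    exec c1 s t1 s1 -> exec c2 s1 t2 s2 -> exec (c1 ;; c2) s (t1 + t2) s2
| ExecWhileF q c s : s.1 q = 0 -> exec (While q c) s 1 s
| ExecWhileT q c s t1 s1 t2 s2 : s.1 q <> 0 ->
    exec c s t1 s1 -> exec (While q c) s1 t2 s2 ->
    exec (While q c) s (1 + (t1 + (1 + t2))) s2
| ExecWhenF q c s : s.1 q = 0 -> exec (When q c) s 1 s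
| ExecWhenT q c s t s' : s.1 q <> 0 ->
    exec c s t s' -> exec (When q c) s (1 + t) s'.

Fixpoint code_size (c : cmd) : nat :=
  match c with
  | Block b => size b
  | c1 ;; c2 => code_size c1 + code_size c2
  | While _ c => (code_size c).+2
  | When _ c => (code_size c).+1
  end.

(** Jumps are absolute, so the address [o] at which the code will be placed is an argument. *)
Fixpoint compile (o : nat) (c : cmd) : seq instr :=
  match c with
  | Block b => b
  | c1 ;; c2 => compile o c1 ++ compile (o + code_size c1) c2
  | While q c => IJz q (o + (code_size c).+2) :: compile o.+1 c ++ [:: IJmp o]
  | When q c => IJz q (o + (code_size c).+1) :: compile o.+1 c
  end.

Lemma size_compile o c : size (compile o c) = code_size c.
Proof.
elim: c o => [b|c1 IH1 c2 IH2|q c IH|q c IH] o //=.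
- by rewrite size_cat IH1 IH2.
- by rewrite size_cat IH addn1.
- by rewrite IH.
Qed.

Lemma runS prog t cf : run prog t.+1 cf = run prog t (step prog cf).
Proof. by []. Qed.

Lemma runD prog t1 t2 cf : run prog (t1 + t2) cf = run prog t2 (run prog t1 cf).
Proof. by elim: t1 cf => [|t1 IH] cf //=; rewrite addSn /= IH. Qed.

Definition at_pc (p : nat) (s : store) : config := Config p s.1 s.2.

Lemma run_block pre b post s : all plain b ->
  run (pre ++ b ++ post) (size b) (at_pc (size pre) s)
  = at_pc (size pre + size b) (foldl effect s b).
Proof.
elim: b pre s => [|i b IH] pre s; first by rewrite addn0.
case/andP=> pi pb; rewrite [size (i :: b)]/= runS !cat_cons [foldl _ _ _]/=.
have -> : step (pre ++ i :: b ++ post) (at_pc (size pre) s)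
    = at_pc (size (rcons pre i)) (effect s i).
  rewrite /step /at_pc nth_cat ltnn subnn /= size_rcons.
  by case: s pi => r m; case: i.
by rewrite -cat_rcons IH // size_rcons addSnnS.
Qed.

(** The surrounding code [pre] and [post] is arbitrary, so that the induction hypotheses apply to
    commands nested in a larger program. *)
Lemma compile_correct c s t s' : exec c s t s' -> forall pre post,
  run (pre ++ compile (size pre) c ++ post) t (at_pc (size pre) s)
  = at_pc (size pre + code_size c) s'.
Proof.
elim=> {c s t s'}.
- by move=> b s pb pre post; rewrite run_block.
- move=> c1 c2 s t1 s1 t2 s2 _ IH1 _ IH2 pre post; rewrite [compile _ _]/=.
  rewrite runD -catA IH1 -(size_compile (size pre) c1) -size_cat catA IH2.
  by rewrite size_cat /= !size_compile addnA.
- move=> q c s q0 pre post /=.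
  by rewrite /at_pc /= nth_cat ltnn subnn /= q0.
- move=> q c s t1 s1 t2 s2 q0 _ IH1 _ IH2 pre post.
  rewrite [compile _ _]/=; set J := IJz _ _.
  rewrite add1n !cat_cons runS.
  have -> : step (pre ++ J :: (compile (size pre).+1 c ++ [:: IJmp (size pre)]) ++ post)
              (at_pc (size pre) s) = at_pc (size (rcons pre J)) s.
    rewrite /step /at_pc nth_cat ltnn subnn /= size_rcons.
    by case: eqP.
  rewrite runD -cat_rcons -catA -(size_rcons pre J) IH1 add1n runS.
  have -> : step (rcons pre J ++ compile (size (rcons pre J)) c
                  ++ [:: IJmp (size pre)] ++ post)
         (at_pc (size (rcons pre J) + code_size c) s1) = at_pc (size pre) s1.
    rewrite /step /at_pc -(size_compile (size (rcons pre J)) c) catA -size_cat.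
    by rewrite nth_cat ltnn subnn.
  by rewrite cat_rcons size_rcons -(IH2 pre post) /= -catA.
- move=> q c s q0 pre post /=.
  by rewrite /at_pc /= nth_cat ltnn subnn /= q0.
- move=> q c s t s' q0 _ IH pre post.
  rewrite [compile _ _]/=; set J := IJz _ _.
  rewrite add1n !cat_cons runS.
  have -> : step (pre ++ J :: compile (size pre).+1 c ++ post)
              (at_pc (size pre) s) = at_pc (size (rcons pre J)) s.
    rewrite /step /at_pc nth_cat ltnn subnn /= size_rcons.
    by case: eqP.
  by rewrite -cat_rcons -(size_rcons pre J) IH size_rcons addSnnS.
Qed.

(** A total-correctness triple with a time bound: termination is part of the claim through the
    existence of [t]. *)
Definition reaches (c : cmd) (s : store) (B : nat) (Q : store -> Prop) : Prop :=
  exists t s', [/\ exec c s t s', t <= B & Q s'].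

Lemma reaches_block b s B (Q : store -> Prop) :
  all plain b -> size b <= B -> Q (foldl effect s b) -> reaches (Block b) s B Q.
Proof. by move=> pb sb Qb; exists (size b), (foldl effect s b); split=> //; constructor. Qed.

Lemma reaches_seq c1 c2 s B1 B2 (Q1 Q : store -> Prop) B :
  reaches c1 s B1 Q1 -> (forall s1, Q1 s1 -> reaches c2 s1 B2 Q) -> B1 + B2 <= B ->
  reaches (c1 ;; c2) s B Q.
Proof.
move=> [t1 [s1 [e1 l1 q1]]] H le_B.
have [t2 [s2 [e2 l2 q2]]] := H _ q1.
exists (t1 + t2), s2; split=> //; first exact: ExecSeq e1 e2.
by apply: leq_trans le_B; rewrite leq_add.
Qed.

Lemma reaches_when q c s B1 B (Q : store -> Prop) :
  (s.1 q <> 0 -> reaches c s B1 Q) -> (s.1 q = 0 -> Q s) -> B1 < B ->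
  reaches (When q c) s B Q.
Proof.
move=> HT HF lB; case: (s.1 q =P 0) => q0.
  by exists 1, s; split=> //; [constructor | apply: leq_ltn_trans lB | exact: HF].
have [t [s' [e l q']]] := HT q0.
by exists (1 + t), s'; split=> //; [apply: ExecWhenT | apply: leq_ltn_trans lB].
Qed.

Lemma reaches_weaken c s B1 B (Q1 Q : store -> Prop) :
  reaches c s B1 Q1 -> (forall s', Q1 s' -> Q s') -> B1 <= B -> reaches c s B Q.
Proof.
move=> [t [s' [e l q]]] H lB; exists t, s'; split=> //; last exact: H.
exact: leq_trans lB.
Qed.

(* [I xs] is the loop invariant when the items of [xs] remain to be processed. *)
Lemma reaches_while A q c (I : seq A -> store -> Prop) (w : A -> nat) xs s :
  (forall x xs s, I (x :: xs) s -> s.1 q <> 0 /\ reaches c s (w x) (I xs)) ->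
  (forall s, I [::] s -> s.1 q = 0) ->
  I xs s -> reaches (While q c) s (\sum_(x <- xs) (w x).+2).+1 (I [::]).
Proof.
move=> HT HF; elim: xs s => [|x xs IH] s Is.
  by exists 1, s; split=> //; constructor; exact: HF.
have [q0 [t1 [s1 [e1 l1 Is1]]]] := HT _ _ _ Is.
have [t2 [s2 [e2 l2 Is2]]] := IH _ Is1.
exists (1 + (t1 + (1 + t2))), s2; split=> //; first exact: ExecWhileT e1 e2.
rewrite big_cons; move: (\sum_(i <- xs) _) l2 => W; lia.
Qed.

(* Registers: 0 and 18 hold the constants 1 and 0; 1 = N; 2 = n; 3 = read pointer;
   4 = outer loop counter; 5 = items left in the current list; 6 = vertex;
   7 = address of the list head of that vertex; 8 = list cell; 9 = first free cell;
   10 = segment; 11, 12 = bases of the list heads and of the hit flags;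
   13 = number of picks; 14 = residual count; 15, 16 = scratch. *)
Definition walk_lengths := While 4 (Block [:: ILoad 5 3; IAdd 3 3 5; IAdd 3 3 0; ISub 4 4 0]).

(** Pushes the current segment on the list of the vertex just read, using two fresh cells. Address 0
    serves as the null pointer. *)
Definition push_incidence := Block
  [:: ILoad 6 3; IAdd 7 11 6; ILoad 8 7; IStore 9 8; IStore 7 9; IAdd 9 9 0;
      IStore 9 10; IAdd 9 9 0; IAdd 3 3 0; ISub 5 5 0].

Definition build_incidences := While 4
  (Block [:: ILoad 5 3; IAdd 3 3 0] ;;
   While 5 push_incidence ;;
   Block [:: IAdd 10 10 0; ISub 4 4 0]).

Definition count_unhit := While 8 (Block
  [:: IAdd 16 8 0; ILoad 10 16; IAdd 16 12 10; ILoad 15 16; ISub 16 0 15;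
      IAdd 14 14 16; ILoad 8 8]).

Definition mark_hit := While 8 (Block
  [:: IAdd 16 8 0; ILoad 10 16; IAdd 16 12 10; IStore 16 0; ILoad 8 8]).

(** Truncated subtraction performs the test: [1 - (j - count)] is nonzero exactly when the count
    reaches [j]. A pick is written at the address given by the number of picks, over input cells
    that are no longer read. *)
Definition greedy_pass j :=
  Block [:: IConst 6 0; IAdd 4 1 18] ;;
  While 4
    (Block [:: IAdd 7 11 6; ILoad 8 7; IConst 14 0] ;;
     count_unhit ;;
     Block [:: IConst 16 j; ISub 16 16 14; ISub 16 0 16] ;;
     When 16 (Block [:: IAdd 13 13 0; IStore 13 6; ILoad 8 7] ;; mark_hit) ;;
     Block [:: IAdd 6 6 0; ISub 4 4 0]).

Definition greedy_program :=
  Block [:: IConst 0 1; ILoad 1 18; ILoad 2 0; IConst 3 2; IAdd 4 2 18] ;;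
  walk_lengths ;;
  Block [:: IAdd 11 3 18; IAdd 12 11 1; IAdd 9 12 2; IConst 3 2; IAdd 4 2 18; IConst 10 0] ;;
  build_incidences ;;
  Block [:: IConst 13 0] ;;
  greedy_pass 4 ;; greedy_pass 2 ;; greedy_pass 1 ;;
  Block [:: IStore 18 13].

(** * The greedy algorithm as a function on lists *)

Section Greedy.

Variables (N : nat) (Ls : seq (seq nat)).

Fixpoint incidences (i : nat) (ls : seq (seq nat)) : seq (nat * nat) :=
  if ls is l :: ls' then [seq (i, v) | v <- l] ++ incidences i.+1 ls' else [::].

(** The reversal mirrors the machine, which prepends each new incidence to the list of its
    vertex. *)
Definition owners (ps : seq (nat * nat)) (v : nat) : seq nat :=
  rev [seq p.1 | p <- ps & p.2 == v].

Definition adj (v : nat) : seq nat := owners (incidences 0 Ls) v.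

Definition hit (out : seq nat) (i : nat) : bool := has (fun v => i \in adj v) out.

Definition residual (out : seq nat) (v : nat) : nat :=
  count (fun i => ~~ hit out i) (adj v).

Definition greedy_step (j : nat) (out : seq nat) (v : nat) : seq nat :=
  if j <= residual out v then rcons out v else out.

Definition greedy_phase (j : nat) (out : seq nat) : seq nat :=
  foldl (greedy_step j) out (iota 0 N).

Definition greedy : seq nat := greedy_phase 1 (greedy_phase 2 (greedy_phase 4 [::])).

Definition nunhit (out : seq nat) : nat :=
  count (fun i => ~~ hit out i) (iota 0 (size Ls)).

Lemma incidencesP i v k : ((i, v) \in incidences k Ls) =
  (k <= i) && (i - k < size Ls) && (v \in nth [::] Ls (i - k)).
Proof.
elim: Ls k => [|l ls IH] k /=; first by rewrite in_nil ltn0 andbF.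
rewrite mem_cat IH; case: (ltngtP i k) => [lt|lt|->].
- rewrite /= orbF; apply/negP=> /mapP[w _ [ik _]]; by rewrite ik ltnn in lt.
- rewrite /= subnS.
  have -> : ((i, v) \in [seq (k, v0) | v0 <- l]) = false.
    by apply/negP=> /mapP[w _ [ik _]]; rewrite ik ltnn in lt.
  by have: 0 < i - k by [rewrite subn_gt0]; case: (i - k).
- rewrite subnn /= orbF.
  by apply/mapP/idP=> [[w wl [->]]//|vl]; exists v.
Qed.

Lemma mem_adj i v : (i \in adj v) = (i < size Ls) && (v \in nth [::] Ls i).
Proof.
rewrite mem_rev; have := incidencesP i v 0; rewrite /= subn0 => <-.
apply/mapP/idP=> [[[i' v']]|h]; first by rewrite mem_filter /= => /andP[/eqP-> h] ->.
by exists (i, v); rewrite // mem_filter /= eqxx.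
Qed.

Lemma adj_lt i v : i \in adj v -> i < size Ls.
Proof. by rewrite mem_adj => /andP[]. Qed.

Hypothesis Ls_uniq : all uniq Ls.

Lemma uniq_adj v : uniq (adj v).
Proof.
rewrite rev_uniq; suff: uniq (incidences 0 Ls).
  move=> u; rewrite map_inj_in_uniq ?filter_uniq // => -[i1 v1] [i2 v2].
  by rewrite !mem_filter /= => /andP[/eqP-> _] /andP[/eqP-> _] ->.
elim: Ls 0 Ls_uniq => [|l ls IH] k //= /andP[ul uls].
rewrite cat_uniq IH // andbT map_inj_uniq ?ul /=; last by move=> ? ? [].
apply/hasPn=> -[i0 v0]; apply: contraL => /mapP[w _ [-> _]].
suff: forall k', k < k' -> (k, v0) \notin incidences k' ls by apply.
elim: ls {IH uls} => [|l' ls' IH'] k' lk //=.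
rewrite mem_cat negb_or IH' ?(leqW lk) // andbT.
by apply/mapP=> -[w' _ [ik _]]; rewrite ik ltnn in lk.
Qed.

Lemma hit_rcons out v i : hit (rcons out v) i = (i \in adj v) || hit out i.
Proof. by rewrite /hit has_rcons. Qed.

(** A pick hits at least [j] new segments, all distinct because [adj] has no repetition. The size
    difference is 1 or 0, so that one inequality covers both outcomes of the test. *)
Lemma nunhit_step j out v : nunhit (greedy_step j out v)
  + j * (size (greedy_step j out v) - size out) <= nunhit out.
Proof.
rewrite /greedy_step; case: ifP => lj; last by rewrite subnn muln0 addn0.
rewrite size_rcons subSnn muln1.
apply: (leq_trans (leq_add (leqnn _) lj)).
rewrite /nunhit /residual -[X in _ + X]size_filter.
have -> : size [seq i <- adj v | ~~ hit out i]
    = count (fun i => (i \in adj v) && ~~ hit out i) (iota 0 (size Ls)).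
  rewrite -size_filter; apply/perm_size/uniq_perm; rewrite ?filter_uniq ?uniq_adj ?iota_uniq //.
  move=> i; rewrite !mem_filter mem_iota /= add0n andbC.
  by case: (boolP (i \in adj v)) => //= /adj_lt ->; rewrite andbT.
rewrite -count_predUI [X in _ + X](eq_count (a2 := pred0)) ?count_pred0 ?addn0.
  by apply: sub_count => i /=; rewrite hit_rcons; case: (i \in _); case: (hit out i).
by move=> i /=; rewrite hit_rcons; case: (i \in _); case: (hit out i).
Qed.

Lemma greedy_step_cat j out v :
  greedy_step j out v = out ++ (if j <= residual out v then [:: v] else [::]).
Proof. by rewrite /greedy_step; case: ifP; rewrite ?cats1 ?cats0. Qed.

Lemma residual_cat out s v : residual (out ++ s) v <= residual out v.
Proof.
by apply: sub_count => i /=; rewrite /hit has_cat negb_or => /andP[].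
Qed.

(** A single scan suffices: residuals only decrease as the output grows, so a rejected vertex stays
    below the threshold, and a picked vertex drops to residual 0. *)
Lemma greedy_phase_spec j out : 0 < j -> exists s,
  [/\ greedy_phase j out = out ++ s, subseq s (iota 0 N),
      nunhit (out ++ s) + j * size s <= nunhit out,
      {in s, forall v, j <= size (adj v)} &
      forall v, v < N -> residual (out ++ s) v < j].
Proof.
move=> j0; suff: forall vs, exists s,
  [/\ foldl (greedy_step j) out vs = out ++ s, subseq s vs,
      nunhit (out ++ s) + j * size s <= nunhit out,
      {in s, forall v, j <= size (adj v)} &
      {in vs, forall v, residual (out ++ s) v < j}].
  move=> /(_ (iota 0 N))[s [h1 h2 h3 h4 h5]]; exists s; split=> // v vN.
  by apply: h5; rewrite mem_iota.
elim/last_ind=> [|vs v [s [h1 h2 h3 h4 h5]]].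
  by exists [::]; rewrite cats0 muln0 addn0; split.
have h := nunhit_step j (out ++ s) v.
have E := greedy_step_cat j (out ++ s) v.
move: E h; rewrite -cats1 foldl_cat h1 /= => E.
rewrite E; case: ifP => lj h; last first.
  exists s; rewrite cats0; split=> //; first exact: subseq_trans h2 (prefix_subseq _ _).
  move=> w; rewrite mem_cat => /orP[/h5//|]; rewrite inE => /eqP->.
  by rewrite ltnNge lj.
exists (s ++ [:: v]); rewrite catA; split=> //.
- by apply: cat_subseq.
- move: h h3; rewrite !size_cat /= addKn; lia.
- move=> w; rewrite mem_cat => /orP[/h4//|]; rewrite inE => /eqP->.
  exact: leq_trans lj (count_size _ _).
- move=> w; rewrite mem_cat => /orP[/h5/(leq_ltn_trans (residual_cat _ _ _))//|].
  rewrite inE => /eqP->; rewrite /residual (eq_in_count (a2 := pred0)) ?count_pred0 //.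
  by move=> i iv; rewrite cats1 hit_rcons iv.
Qed.

End Greedy.

(** * Correctness and running time of the machine program *)

Fixpoint reads (m : nat -> nat) (p : nat) (s : seq nat) : Prop :=
  if s is x :: s' then m p = x /\ reads m p.+1 s' else True.

Lemma reads_cat m p s1 s2 :
  reads m p (s1 ++ s2) <-> reads m p s1 /\ reads m (p + size s1) s2.
Proof.
elim: s1 p => [|x s1 IH] p /=; first by rewrite addn0; tauto.
by rewrite IH addSnnS; tauto.
Qed.

Lemma eq_reads m m' p s : (forall a, p <= a < p + size s -> m' a = m a) ->
  reads m p s -> reads m' p s.
Proof.
elim: s p => [|x s IH] p //= E [<- h]; split; first by apply: E; lia.
by apply: IH h => a ha; apply: E; lia.
Qed.

Lemma reads_nth s0 s : reads (fun a => nth 0 (s0 ++ s) a) (size s0) s.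
Proof.
elim: s s0 => [|x s IH] s0 //=; split; first by rewrite nth_cat ltnn subnn.
by rewrite -cat_rcons -(size_rcons s0 x); apply: IH.
Qed.

Definition flat (ls : seq (seq nat)) : seq nat := flatten [seq size l :: l | l <- ls].

Lemma flat_cons l ls : flat (l :: ls) = size l :: l ++ flat ls.
Proof. by []. Qed.

(* A linked list with cells [p, p + 1] = [next, item], all in [[b, q)]. *)
Fixpoint linked (m : nat -> nat) (b q p : nat) (s : seq nat) : Prop :=
  if s is i :: s' then [/\ b <= p, p.+1 < q, m p.+1 = i & linked m b q (m p) s']
  else p = 0.

(** Frame rule: a list survives memory changes outside the region of its cells, and the region may
    grow. *)
Lemma eq_linked m m' b q q' p s : q <= q' ->
  (forall a, b <= a < q -> m' a = m a) -> linked m b q p s -> linked m' b q' p s.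
Proof.
move=> lq E; elim: s p => [|i s IH] p //= [h1 h2 h3 h4]; split=> //.
- lia.
- by rewrite E //; lia.
by rewrite E; [exact: IH | lia].
Qed.

(** * Loop invariants and step counts *)

Section Program.

Variables (N : nat) (Ls : seq (seq nat)).
Hypothesis Ls_lt : all (all (fun v => v < N)) Ls.
Hypothesis Ls_uniq : all uniq Ls.

Let n := size Ls.
(** Memory layout: the input, with its two header cells, fills the addresses below [Z]; then come
    [N] list heads from [H], [n] hit flags from [F], and the list cells from [B] on. *)
Let Z := (size (flat Ls)).+2.
Let H := Z.
Let F := Z + N.
Let B := Z + N + n.

Definition consts (r : nat -> nat) : Prop := [/\ r 0 = 1, r 18 = 0, r 1 = N & r 2 = n].

Definition m_init : nat -> nat := fun a => nth 0 (N :: n :: flat Ls) a.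

Definition walk_inv (ls : seq (seq nat)) (s : store) : Prop :=
  [/\ consts s.1, s.1 4 = size ls, reads s.2 (s.1 3) (flat ls),
      s.1 3 + size (flat ls) = Z & s.2 = m_init].

Lemma walk_step l ls s : walk_inv (l :: ls) s -> s.1 4 <> 0 /\
  reaches (Block [:: ILoad 5 3; IAdd 3 3 5; IAdd 3 3 0; ISub 4 4 0]) s 4 (walk_inv ls).
Proof.
case: s => r m; rewrite {1}/walk_inv /consts /= =>
  -[[c1 c2 c3 c4] h4 [h3 hr] hZ hm]; split; first by rewrite h4.
apply: reaches_block => //=; rewrite /walk_inv /consts /upd /= c1 c2 c3 c4 h3 h4.
move: hr; rewrite reads_cat => -[_ hr]; split=> //.
- by rewrite subn1.
- by rewrite addn1 -addSn.
- by rewrite -hZ size_cat -!/(flat _); lia.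
Qed.

Lemma walk_correct s : walk_inv Ls s ->
  reaches walk_lengths s (\sum_(l <- Ls) 6).+1 (walk_inv [::]).
Proof.
by move=> I0; apply: (reaches_while (w := fun=> 4)) I0 => [l ls s' |s' []//]; exact: walk_step.
Qed.

Definition build_mem (m : nat -> nat) (q : nat) (ps : seq (nat * nat)) : Prop :=
  [/\ forall a, 1 < a < Z -> m a = m_init a,
      forall i, i < n -> m (F + i) = 0,
      B <= q &
      forall v, v < N -> linked m B q (m (H + v)) (owners ps v)].

Definition bases (r : nat -> nat) : Prop := r 11 = H /\ r 12 = F.

Definition push_inv (k i : nat) ps0 (l0 : seq nat) (tl : seq nat) (l : seq nat) (s : store) : Prop :=
  [/\ consts s.1, bases s.1, (s.1 4 = k /\ s.1 10 = i),
      [/\ s.1 5 = size l, reads s.2 (s.1 3) (l ++ tl) & s.1 3 + size (l ++ tl) = Z ] &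
      [/\ all (fun v => v < N) l, (1 < s.1 3) & exists l', l0 = l' ++ l /\
        build_mem s.2 (s.1 9) (ps0 ++ [seq (i, v) | v <- l'])]].

Lemma owners_rcons ps i v w :
  owners (rcons ps (i, v)) w = if v == w then i :: owners ps w else owners ps w.
Proof.
rewrite /owners filter_rcons /=; case: eqP => //= _.
by rewrite map_rcons rev_rcons.
Qed.

Lemma push_step k i ps0 l0 tl v l s : push_inv k i ps0 l0 tl (v :: l) s -> s.1 5 <> 0 /\
  reaches push_incidence s 10 (push_inv k i ps0 l0 tl l).
Proof.
case: s => r m; rewrite {1}/push_inv /consts /bases /= =>
  -[[c1 c2 c3 c4] [b1 b2] [h4 h10] [h5 [hv hr] hZ]] [/andP[vN lN] h3 [l' [E [M1 M2 M3 M4]]]].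
split; first by rewrite h5.
apply: reaches_block => //=.
rewrite /push_inv /consts /bases /upd /= c1 c2 c3 c4 b1 b2 h4 h10 h5 hv /=.
set q := r 9 in M3 M4 *.
have Zl : Z <= H + v by rewrite /H; lia.
set m' := fun b => _.
have m'E a : a != H + v -> a != q -> a != q + 1 -> m' a = m a.
  by rewrite /m' => /negPf-> /negPf-> /negPf->.
have szZ : r 3 + (size l + size tl).+1 = Z by rewrite -size_cat -hZ.
split=> //.
- split; first by rewrite subn1.
  + rewrite addn1; apply: eq_reads hr => a; rewrite size_cat => ha; apply: m'E; rewrite /H /B in M3 *; lia.
  + by rewrite addn1 size_cat; lia.
split=> //; first lia.
exists (rcons l' v); split; first by rewrite cat_rcons.
rewrite map_rcons -rcons_cat.
have Hq : H + v < q by rewrite /B /H in M3 *; lia.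
split.
- by move=> a /andP[a1 a2]; rewrite -M1 ?a1 //; apply: m'E; rewrite /H in Zl Hq *; lia.
- by move=> j jn; rewrite -(M2 _ jn); apply: m'E; rewrite /H /F /B in M3 *; lia.
- lia.
move=> w wN; rewrite owners_rcons.
have L : linked m' B (q + 1 + 1) (m (H + w)) (owners (ps0 ++ [seq (i, v0) | v0 <- l']) w).
  apply: eq_linked (M4 _ wN); first lia.
  by move=> a ha; apply: m'E; rewrite /B /H in M3 ha *; lia.
case: eqP => [vw|/eqP vw] /=.
  subst w; have -> : m' (H + v) = q by rewrite /m' eqxx; case: eqP => //; lia.
  have -> : m' q.+1 = i by rewrite /m' addn1 eqxx.
  have -> : m' q = m (H + v).
    have -> : m' q = if q == q + 1 then i else if q == H + v then q else
                     if q == q then m (H + v) else m q by [].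
    by rewrite eqxx; case: eqP => [|_]; [lia | case: eqP => [|_]; [lia|]].
  by split=> //; lia.
rewrite m'E //; rewrite ?eqn_add2l 1?eq_sym //; rewrite /B /H in M3 *; lia.
Qed.

Definition build_inv (ls : seq (seq nat)) (s : store) : Prop :=
  [/\ consts s.1, bases s.1, s.1 4 = size ls,
      [/\ reads s.2 (s.1 3) (flat ls), s.1 3 + size (flat ls) = Z & 1 < s.1 3] &
      all (all (fun v => v < N)) ls /\
      exists ls', [/\ Ls = ls' ++ ls, s.1 10 = size ls' &
        build_mem s.2 (s.1 9) (incidences 0 ls')]].

Lemma incidences_rcons k ls l :
  incidences k (rcons ls l) = incidences k ls ++ [seq (k + size ls, v) | v <- l].
Proof.
elim: ls k => [|l' ls IH] k /=; first by rewrite cats0 addn0.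
by rewrite IH catA addSnnS.
Qed.

Lemma build_step l ls s : build_inv (l :: ls) s -> s.1 4 <> 0 /\
  reaches (Block [:: ILoad 5 3; IAdd 3 3 0] ;; While 5 push_incidence ;;
           Block [:: IAdd 10 10 0; ISub 4 4 0]) s (5 + \sum_(v <- l) 12) (build_inv ls).
Proof.
case: s => r m; rewrite {1}/build_inv /consts /bases /= =>
  -[[c1 c2 c3 c4] [b1 b2] h4 [[h3 hr] hZ h31] [/andP[lN lsN] [ls' [E h10 BM]]]].
split; first by rewrite h4.
apply: (@reaches_seq _ _ _ 2 (3 + \sum_(v <- l) 12)
  (push_inv (size ls).+1 (size ls') (incidences 0 ls') l (flat ls) l)); last lia.
  apply: reaches_block => //=; rewrite /push_inv /consts /bases /upd /=.
  split=> //; first by rewrite c1 h3 addn1; split=> //; rewrite -hZ addSnnS.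
  split=> //; first by rewrite c1; lia.
  by exists [::]; rewrite cats0.
move=> s1 I1; apply: (@reaches_seq _ _ _ (\sum_(v <- l) 12).+1 2
  (push_inv (size ls).+1 (size ls') (incidences 0 ls') l (flat ls) [::])); last lia.
  apply: (reaches_while (w := fun=> 10)) I1 => [v l1 s'|s' []//]; first exact: push_step.
  by move=> _ _ _ [].
case=> r' m'; rewrite {1}/push_inv /consts /bases /= =>
  -[[c1' c2' c3' c4'] [b1' b2'] [h4' h10'] [h5' hr' hZ'] [_ h3' [l' [El BM']]]].
apply: reaches_block => //=; rewrite /build_inv /consts /bases /upd /= c1' c2' c3' c4' h4' h10'.
split=> //; first by rewrite subn1.
split=> //; exists (rcons ls' l); rewrite cat_rcons size_rcons addn1; split=> //.
by rewrite incidences_rcons add0n El cats0.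
Qed.

Lemma build_correct s : build_inv Ls s ->
  reaches build_incidences s (\sum_(l <- Ls) (5 + \sum_(v <- l) 12).+2).+1 (build_inv [::]).
Proof.
by move=> I0; apply: reaches_while I0 => [l ls s' |s' []//]; exact: build_step.
Qed.


Definition greedy_mem (m : nat -> nat) (q : nat) (out : seq nat) : Prop :=
  [/\ forall v, v < N -> linked m B q (m (H + v)) (adj Ls v),
      forall i, i < n -> m (F + i) = hit Ls out i &
      forall k, k < size out -> m k.+1 = nth 0 out k].

(** The predicate [P] on the visited prefix is a parameter because counting and marking walk along
    the same list. *)
Definition scan_inv (k v K a q : nat) (P : seq nat -> nat -> (nat -> nat) -> Prop)
    (xs : seq nat) (s : store) : Prop :=
  [/\ consts s.1, bases s.1, [/\ s.1 4 = k, s.1 6 = v, s.1 13 = K & s.1 7 = a],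
      linked s.2 B q (s.1 8) xs &
      exists2 xs', adj Ls v = xs' ++ xs & P xs' (s.1 14) s.2].

(** Cells live at or above [B], which is positive, so a cell is never mistaken for the null
    pointer. *)
Lemma linked0 m q p i xs : linked m B q p (i :: xs) -> p <> 0.
Proof. by rewrite /B /Z => -[h _ _ _]; lia. Qed.

Lemma count_step k v K a q out m i xs s :
  let I := scan_inv k v K a q (fun xs' c m' =>
    [/\ m' = m, greedy_mem m q out & c = count (fun i => ~~ hit Ls out i) xs']) in
  I (i :: xs) s -> s.1 8 <> 0 /\
  reaches (Block [:: IAdd 16 8 0; ILoad 10 16; IAdd 16 12 10; ILoad 15 16; ISub 16 0 15;
      IAdd 14 14 16; ILoad 8 8]) s 7 (I xs).
Proof.
case: s => r m1; rewrite /= {1}/scan_inv /consts /bases /= => -[[c1 c2 c3 c4] [b1 b2]].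
move=> [h4 h6 h13 h7] L [xs' E [mE GM h14]]; split; first exact: (@linked0 _ _ _ i xs L).
case: L => [l1 l2 l3 L]; subst m1.
have ilt : i < n by apply: (@adj_lt Ls i v); rewrite E mem_cat inE eqxx orbT.
apply: reaches_block => //=; rewrite /scan_inv /consts /bases /upd /=.
split=> //; exists (rcons xs' i); first by rewrite cat_rcons.
split=> //; rewrite -cats1 count_cat -h14 /= addn0 c1 addn1 l3 b2.
by case: GM => _ -> // _; case: (hit _ _ _).
Qed.

Lemma count_correct k v K a q out m s : 
  let I := scan_inv k v K a q (fun xs' c m' =>
    [/\ m' = m, greedy_mem m q out & c = count (fun i => ~~ hit Ls out i) xs']) in
  I (adj Ls v) s -> reaches count_unhit s (\sum_(x <- adj Ls v) 9).+1 (I [::]).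
Proof.
move=> I I0; apply: (reaches_while (w := fun=> 7)) I0 => [i xs s' | s' []//].
exact: count_step.
Qed.

(** Marking writes only in the flag region between [F] and [B]; the list heads, the cells and the
    picks are therefore those of the earlier memory [m0]. *)
Lemma mark_step k v K a q out m0 i xs s :
  let I := scan_inv k v K a q (fun xs' c m' =>
    (forall i, i < n -> m' (F + i) = hit Ls out i || (i \in xs')) /\
    (forall b, ~~ (F <= b < B) -> m' b = m0 b)) in
  I (i :: xs) s -> s.1 8 <> 0 /\
  reaches (Block [:: IAdd 16 8 0; ILoad 10 16; IAdd 16 12 10; IStore 16 0; ILoad 8 8])
    s 5 (I xs).
Proof.
case: s => r m1; rewrite /= {1}/scan_inv /consts /bases /= => -[[c1 c2 c3 c4] [b1 b2]].
move=> [h4 h6 h13 h7] L [xs' E [hF hm]]; split; first exact: (@linked0 _ _ _ i xs L).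
case: L => [l1 l2 l3 L].
have ilt : i < n by apply: (@adj_lt Ls i v); rewrite E mem_cat inE eqxx orbT.
apply: reaches_block => //=; rewrite /scan_inv /consts /bases /upd /= c1 addn1 l3 b2.
set m' := fun b => _.
have m'E b : b != F + i -> m' b = m1 b by rewrite /m' => /negPf->.
have FB : F + i < B by rewrite /F /B ltn_add2l.
split=> //.
  have -> : (if r 8 == F + i then 1 else m1 (r 8)) = m1 (r 8).
    by case: eqP => // e; lia.
  by apply: eq_linked L => // b hb; apply: m'E; lia.
exists (rcons xs' i); first by rewrite cat_rcons.
split=> [i' i'n|b hb]; last by rewrite -[LHS]/(m' b) m'E ?hm //; lia.
rewrite mem_rcons inE /m' eqn_add2l; case: eqP => [_|_] /=; first by rewrite orbT.
exact: hF.
Qed.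

Lemma mark_correct k v K a q out m0 s :
  let I := scan_inv k v K a q (fun xs' c m' =>
    (forall i, i < n -> m' (F + i) = hit Ls out i || (i \in xs')) /\
    (forall b, ~~ (F <= b < B) -> m' b = m0 b)) in
  I (adj Ls v) s -> reaches mark_hit s (\sum_(x <- adj Ls v) 7).+1 (I [::]).
Proof.
move=> I I0; apply: (reaches_while (w := fun=> 5)) I0 => [i xs s' | s' []//].
exact: mark_step.
Qed.

(** The final result [tgt] is fixed and the scan of the remaining vertices has to lead to it, so the
    processed vertices need no record. The bound on [size out] keeps the picks inside the input
    area. *)
Definition pass_inv (j : nat) (tgt vs : seq nat) (s : store) : Prop :=
  [/\ consts s.1, bases s.1, [/\ s.1 4 = size vs, vs = iota (s.1 6) (size vs) &
      s.1 6 + size vs = N] &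
      exists q out, [/\ s.1 13 = size out, greedy_mem s.2 q out,
        nunhit Ls out + size out <= n & foldl (greedy_step Ls j) out vs = tgt]].

Lemma size_flat ls : size (flat ls) = size ls + \sum_(l <- ls) size l.
Proof.
elim: ls => [|l ls IH]; first by rewrite big_nil.
by rewrite flat_cons /= size_cat IH big_cons; lia.
Qed.

Lemma pass_step j tgt v vs s : 0 < j -> pass_inv j tgt (v :: vs) s -> s.1 4 <> 0 /\
  reaches (Block [:: IAdd 7 11 6; ILoad 8 7; IConst 14 0] ;;
     count_unhit ;;
     Block [:: IConst 16 j; ISub 16 16 14; ISub 16 0 16] ;;
     When 16 (Block [:: IAdd 13 13 0; IStore 13 6; ILoad 8 7] ;; mark_hit) ;;
     Block [:: IAdd 6 6 0; ISub 4 4 0]) s (15 + 16 * size (adj Ls v)) (pass_inv j tgt vs).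
Proof.
move=> j0; case: s => r m; rewrite {1}/pass_inv /consts /bases /= => -[[c1 c2 c3 c4] [b1 b2]].
move=> [h4 [hv hvs] hN] [q [out [h13 GM hout htgt]]]; split; first by rewrite h4.
have vN : v < N by lia.
have vsE : vs = iota v.+1 (size vs) by rewrite {1}hvs -hv.
have vsN : v.+1 + size vs = N by lia.
set a := H + v; pose cnt := residual Ls out v.
set I := scan_inv (size vs).+1 v (size out) a q (fun xs' c m' =>
    [/\ m' = m, greedy_mem m q out & c = count (fun i => ~~ hit Ls out i) xs']).
have sumE c : \sum_(x <- adj Ls v) c = c * size (adj Ls v).
  by rewrite big_const_seq count_predT iter_addn_0.
apply: (@reaches_seq _ _ _ 3 (12 + 16 * size (adj Ls v)) (I (adj Ls v))); last lia.
  apply: reaches_block => //=; rewrite /I /scan_inv /consts /bases /upd /= b1 -hv.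
  split=> //; first by case: GM => GM _ _; exact: GM.
  by exists [::].
move=> s1 /count_correct R1.
apply: (reaches_seq (B2 := 11 + 7 * size (adj Ls v)) R1); last by rewrite sumE; lia.
case=> {R1 c1 c2 c3 c4 b1 b2 h4 h13 hv hvs hN} r1 m1.
rewrite {1}/scan_inv /consts /bases /= => -[[c1 c2 c3 c4] [b1 b2] [h4 h6 h13 h7] _].
case=> xs; rewrite cats0 => <- [{xs}-> _ h14].
apply: (@reaches_seq _ _ _ 3 (8 + 7 * size (adj Ls v)) (fun s =>
  [/\ consts s.1, bases s.1, [/\ s.1 4 = (size vs).+1, s.1 6 = v, s.1 13 = size out & s.1 7 = a]
    & s.2 = m /\ s.1 16 = 1 - (j - cnt)])); last lia.
  by apply: reaches_block => //=; rewrite /consts /bases /upd /= c1 h14.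
case=> {c1 c2 c3 c4 b1 b2 h4 h6 h13 h7 h14} r2 m2; rewrite {1}/consts {1}/bases /=.
move=> [[c1 c2 c3 c4] [b1 b2] [h4 h6 h13 h7] [{m2}-> h16]].
apply: (@reaches_seq _ _ _ (6 + 7 * size (adj Ls v)) 2 (fun s =>
  [/\ consts s.1, bases s.1, s.1 4 = (size vs).+1 /\ s.1 6 = v
    & let out' := greedy_step Ls j out v in s.1 13 = size out' /\ greedy_mem s.2 q out']));
  last lia; last first.
  case=> {c1 c2 c3 c4 b1 b2 h4 h6 h13 h7 h16} r3 m3; rewrite {1}/consts {1}/bases /=.
  move=> [[c1 c2 c3 c4] [b1 b2] [h4 h6] [h13 GM']].
  apply: reaches_block => //=; rewrite /pass_inv /consts /bases /upd /= c1 h4 subn1 /= h6 addn1.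
  split=> //.
  exists q, (greedy_step Ls j out v); split=> //.
  have := nunhit_step Ls_uniq j out v.
  rewrite greedy_step_cat size_cat addKn; case: ifP => _ /=; last lia.
  (* As [0 < j], a pick lowers the number of unhit segments by at least one, which pays for the
     longer output. *)
  by move: (nunhit _ _) => w; move: hout; rewrite -/n; nia.
apply: (reaches_when (B1 := 5 + 7 * size (adj Ls v))); last lia.
  rewrite /= h16 => /eqP h; have lj : j <= cnt by move: h; lia.
  apply: (@reaches_seq _ _ _ 3 (2 + 7 * size (adj Ls v))
    (scan_inv (size vs).+1 v (size out).+1 a q (fun xs' c m' =>
    (forall i, i < n -> m' (F + i) = hit Ls out i || (i \in xs')) /\
    (forall b, ~~ (F <= b < B) -> m' b = upd m (size out).+1 v b)) (adj Ls v))); last lia.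
    (* At most [n] picks precede, and the input has at least [n + 2] cells, so the new pick
       overwrites neither heads, flags nor list cells. *)
    have outZ : (size out).+1 < Z by rewrite /Z size_flat -/n; lia.
    have mE b : b != (size out).+1 -> upd m (size out).+1 v b = m b.
      by rewrite /upd => /negPf->.
    case: GM => GM1 GM2 GM3.
    apply: reaches_block => //=; rewrite /scan_inv /consts /bases.
    rewrite /upd /= -!/(upd _ _ _) c1 h13 h6 h7 addn1.
    rewrite -[if a == _ then _ else _]/(upd m (size out).+1 v a) -/(upd m (size out).+1 v).
    rewrite mE; last by rewrite /a /H; lia.
    split=> //.
      by apply: eq_linked (GM1 _ vN) => // b hb; apply: mE; rewrite /B in hb; lia.
    exists [::] => //; split=> // i ilt.
    by rewrite -[LHS]/(upd m (size out).+1 v (F + i)) mE ?orbF ?GM2 //; rewrite /F; lia.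
  move=> s2 /mark_correct R2; apply: (reaches_weaken R2); last by rewrite sumE; lia.
  case=> r3 m3; rewrite {1}/scan_inv /= => -[C3 B3 [g4 g6 g13 g7] _ [xs]].
  rewrite cats0 => <- [hF hm]; rewrite /greedy_step -/cnt lj size_rcons.
  split=> //; split=> //; case: GM => GM1 GM2 GM3.
  have outZ : (size out).+1 < Z by rewrite /Z size_flat -/n; lia.
  split.
  - move=> w wN; rewrite hm; last by rewrite /F /H; lia.
    have mE b : b != (size out).+1 -> upd m (size out).+1 v b = m b.
      by rewrite /upd => /negPf->.
    rewrite mE; last by rewrite /H; lia.
    apply: eq_linked (GM1 _ wN) => // b hb; rewrite hm; last lia.
    by rewrite mE //; rewrite /B in hb; lia.
  - by move=> i ilt; rewrite hF // hit_rcons orbC.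
  - move=> k; rewrite size_rcons => hk; rewrite hm; last by rewrite /F; lia.
    rewrite /upd eqSS nth_rcons; case: eqP => [->|/eqP ne]; first by rewrite ltnn.
    have lk : k < size out by lia.
    by rewrite lk; exact: GM3.
rewrite /= h16 => h; have lj : (j <= cnt) = false by move: h; lia.
by rewrite /greedy_step -/cnt lj.
Qed.

(** Double counting of incidences, so that the scans of all lists in a pass take linear time
    together. *)
Lemma sum_incidences ps : all (fun p => p.2 < N) ps ->
  \sum_(v <- iota 0 N) size (owners ps v) = size ps.
Proof.
move=> h; transitivity (\sum_(v <- iota 0 N) \sum_(p <- ps) (p.2 == v : nat)).
  by apply: eq_bigr => v _; rewrite size_rev size_map size_filter -sum1_count big_mkcond.
rewrite exchange_big /= -sum1_size big_seq [RHS]big_seq; apply: eq_bigr => p pps.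
have pN := allP h _ pps; rewrite (bigD1_seq p.2) ?iota_uniq ?mem_iota //= eqxx.
by rewrite big1 // => v; rewrite eq_sym => /negPf->.
Qed.

Lemma size_incidences k ls : size (incidences k ls) = \sum_(l <- ls) size l.
Proof.
elim: ls k => [|l ls IH] k; first by rewrite big_nil.
by rewrite /= size_cat size_map IH big_cons.
Qed.

Lemma incidences_lt k ls : all (all (fun v => v < N)) ls ->
  all (fun p => p.2 < N) (incidences k ls).
Proof.
elim: ls k => [|l ls IH] k //= /andP[hl hls].
by rewrite all_cat IH // andbT all_map.
Qed.

Let M := \sum_(l <- Ls) size l.

Lemma pass_correct j out s : 0 < j -> consts s.1 -> bases s.1 ->
  s.1 13 = size out -> (exists q, greedy_mem s.2 q out) -> nunhit Ls out + size out <= n ->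
  reaches (greedy_pass j) s (3 + 17 * N + 16 * M) (fun s' =>
    let out' := greedy_phase N Ls j out in
    [/\ consts s'.1, bases s'.1, s'.1 13 = size out', (exists q, greedy_mem s'.2 q out') &
        nunhit Ls out' + size out' <= n]).
Proof.
move=> j0; case: s => r m; rewrite {1}/consts {1}/bases /=.
move=> [c1 c2 c3 c4] [b1 b2] h13 [q GM] hout.
set tgt := greedy_phase N Ls j out.
apply: (@reaches_seq _ _ _ 2 (1 + 17 * N + 16 * M) (pass_inv j tgt (iota 0 N))); last lia.
  apply: reaches_block => //=; rewrite /pass_inv /consts /bases /upd /= c3 c2 addn0 size_iota.
  by split=> //; exists q, out; split.
move=> s1 I1; have R : reaches (While 4
    (Block [:: IAdd 7 11 6; ILoad 8 7; IConst 14 0] ;;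
     count_unhit ;;
     Block [:: IConst 16 j; ISub 16 16 14; ISub 16 0 16] ;;
     When 16 (Block [:: IAdd 13 13 0; IStore 13 6; ILoad 8 7] ;; mark_hit) ;;
     Block [:: IAdd 6 6 0; ISub 4 4 0])) s1
     (\sum_(v <- iota 0 N) (15 + 16 * size (adj Ls v)).+2).+1 (pass_inv j tgt [::]).
  apply: reaches_while I1 => [v vs s' | s' [] // _ _ []//].
  exact: pass_step.
apply: (reaches_weaken R).
  case=> r' m' [C' B' _ [q' [out' [h13' GM' hout' <-]]]].
  by split=> //; exists q'.
rewrite (eq_bigr (fun v => 17 + 16 * size (adj Ls v))) //.
rewrite big_split /= -big_distrr /= big_const_seq count_predT size_iota iter_addn_0.
by rewrite sum_incidences ?incidences_lt // size_incidences -/M; lia.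
Qed.

Lemma sum_addc (c : nat) (f : seq nat -> nat) :
  \sum_(l <- Ls) (c + f l) = c * n + \sum_(l <- Ls) f l.
Proof. by rewrite big_split /= big_const_seq count_predT iter_addn_0. Qed.

(** The constant 100 is generous; each [B2] below is the budget granted to the phases still to
    run. *)
Lemma greedy_program_correct :
  reaches greedy_program (fun=> 0, m_init) (100 * (1 + N + n + M)) (fun s' =>
    output s'.2 = greedy N Ls).
Proof.
apply: (@reaches_seq _ _ _ 5 (94 + 99 * (N + n + M)) (walk_inv Ls)); last lia.
  apply: reaches_block => //=; rewrite /walk_inv /consts /upd /= /m_init /= addn0.
  by split=> //; exact: (reads_nth [:: N; n] (flat Ls)).
move=> s1 /walk_correct R1; apply: (reaches_seq (B2 := 93 + 91 * (N + n + M)) R1); last first.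
  have := sum_addc 6 (fun=> 0); rewrite big1_eq (eq_bigr (fun=> 6)) // => ->.
  lia.
case=> {R1 s1} r m; rewrite {1}/walk_inv /consts /= => -[[c1 c2 c3 c4] h4 _ hZ hm].
apply: (@reaches_seq _ _ _ 6 (87 + 91 * (N + n + M)) (build_inv Ls)); last lia.
  apply: reaches_block => //=; rewrite /build_inv /consts /bases /upd /= c1 c2 c3 c4 !addn0.
  move: hZ; rewrite addn0 => ->.
  (* Memory beyond the input reads 0, so heads are null and flags are clear without any
     initialisation. *)
  have m0 a : Z <= a -> m a = 0 by move=> ha; rewrite hm /m_init nth_default.
  split=> //.
  - by split=> //; rewrite hm; exact: (reads_nth [:: N; n] (flat Ls)).
  - split=> //; exists [::]; split=> //; split=> //.
    + by move=> a _; rewrite hm.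
    + by move=> i _; rewrite m0 // /F; lia.
    + by move=> v _; rewrite /= m0 // /H; lia.
move=> s1 /build_correct R1; apply: (reaches_seq (B2 := 70 + 60 * (N + n + M)) R1); last first.
  rewrite (eq_bigr (fun l => 7 + 12 * size l)); last first.
    by move=> l _; rewrite big_const_seq count_predT iter_addn_0.
  by rewrite sum_addc -big_distrr /= -/M; lia.
case=> {R1 s1 c1 c2 c3 c4 h4 hm hZ m} r1 m; rewrite {1}/build_inv /= =>
  -[C1 B1 _ [hr _ _] [_ [ls [E _ [M1 M2 M3 M4]]]]].
have {}E : Ls = ls by rewrite E cats0.
have adjE v : owners (incidences 0 ls) v = adj Ls v by rewrite E.
have GM0 : exists q, greedy_mem m q [::].
  exists (r1 9); split=> [v vN|i ilt|k]; last by [].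
  - by rewrite -adjE; exact: M4.
  - exact: M2.
apply: (@reaches_seq _ _ _ 1 (69 + 60 * (N + n + M)) (fun s => [/\ consts s.1, bases s.1,
  s.1 13 = size ([::] : seq nat), (exists q, greedy_mem s.2 q [::])
  & nunhit Ls [::] + size ([::] : seq nat) <= n])); last lia.
  apply: reaches_block => //; split=> //=; rewrite addn0.
  by apply: leq_trans (count_size _ _) _; rewrite size_iota.
move=> s4 [C4 B4 K4 G4 U4].
have R4 := pass_correct (isT : 0 < 4) C4 B4 K4 G4 U4.
apply: (reaches_seq (B2 := 66 + 43 * N + 44 * M) R4); last lia.
move=> s2 [C2 B2 K2 G2 U2].
have R2 := pass_correct (isT : 0 < 2) C2 B2 K2 G2 U2.
apply: (reaches_seq (B2 := 63 + 26 * N + 28 * M) R2); last lia.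
move=> s5 [C5 B5 K5 G5 U5].
have R5 := pass_correct (isT : 0 < 1) C5 B5 K5 G5 U5.
apply: (reaches_seq (B2 := 1) R5); last lia.
case=> r' m' /= [[_ c2 _ _] _ K [q [_ _ Q]] _].
apply: reaches_block => //=; rewrite /output /upd /= c2 eqxx K -/(greedy N Ls).
apply: (@eq_from_nth _ 0) => [|k]; rewrite size_map size_iota // => hk.
by rewrite (nth_map 0) ?size_iota // nth_iota //= add0n Q.
Qed.

End Program.

Lemma greedy_program_runs : exists prog C, forall N Ls,
  all (all (fun v => v < N)) Ls -> all uniq Ls ->
  exists t, let cf := run prog t (init_config (N :: size Ls :: flat Ls)) in
  [/\ t <= C * (1 + N + size Ls + \sum_(l <- Ls) size l), halted prog cf &
      output (cf_mem cf) = greedy N Ls].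
Proof.
exists (compile 0 greedy_program), 100 => N Ls Ls_lt Ls_uniq.
have [t [s' [e lt out]]] := greedy_program_correct Ls_lt Ls_uniq.
exists t; have := compile_correct e [::] [::]; rewrite cats0 /= => ->.
(* The machine stops by running off the end of the code, where the default of [nth] is [IHalt]. *)
by split=> //; rewrite /halted /= add0n nth_default // size_compile.
Qed.

(** * Counting edges by a sweep *)

(** Links are processed one at a time as in union-find: the class of [a] is redirected to that of
    [b], which removes at most one value of [f]. *)
Lemma quotient_by_links (T : finType) (lk : seq (T * T)) : exists f : T -> T,
  (forall p, p \in lk -> f p.1 = f p.2) /\ #|T| <= #|[set f x | x : T]| + size lk.
Proof.
elim: lk => [|[a b] lk [f [fE fT]]].
  exists id; split=> //; rewrite addn0 -[X in X <= _]cardsT; apply: subset_leq_card.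
  by apply/subsetP=> x _; apply/imsetP; exists x.
exists (fun x => if f x == f a then f b else f x); split.
  move=> p; rewrite inE => /orP[/eqP-> /=|/fE->//].
  by rewrite eqxx; case: eqP.
apply: leq_trans fT _; rewrite /= addnS -addSn leq_add2r.
rewrite (cardsD1 (f a)) -add1n leq_add ?leq_b1 //; apply: subset_leq_card.
apply/subsetP=> y; rewrite !inE => /andP[ya /imsetP[x _ yx]].
by apply/imsetP; exists x; rewrite // -yx (negPf ya).
Qed.

Section Gaps.

Variables (E : finType) (C : eqType) (f : option (E * bool) -> C).

(* [Some (e, true)] is the upper side of [e], [Some (e, false)] its lower side,
   and [None] stands for infinity. *)
Definition side (b : bool) (o : option E) : option (E * bool) :=
  omap (fun e => (e, b)) o.

Definition adj_sides (o o' : option E) : bool := f (side true o) == f (side false o').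

(** Read as a path from [None], the list also ends in [None]: the cells under the lowest edge and
    over the highest one are identified with infinity. *)
Definition slab (s : seq E) : seq (option E) := rcons (map Some s) None.

Definition gaps_ok (s : seq E) : bool := path adj_sides None (slab s).

End Gaps.

Section Sweep.

(** Vertices are numbered from left to right and [e] runs from [l e] to [r e]. [A j] lists from
    bottom to top the edges over the slab just left of vertex [j]; at [j] the block [L j] of ending
    edges gives way to the block [R j] of starting ones, with [P j] passing below and [Q j]
    above. *)
Variables (E : finType) (V : nat) (l r : E -> nat) (A P L R Q : nat -> seq E).
Hypothesis mem_A : forall j e, (e \in A j) = (l e < j <= r e).
Hypothesis r_lt : forall e, r e < V.
Hypothesis uniq_A : forall j, uniq (A j).
Hypothesis A_left : forall j, j < V -> A j = P j ++ L j ++ Q j.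
Hypothesis A_right : forall j, j < V -> A j.+1 = P j ++ R j ++ Q j.
Hypothesis L_ends : forall j e, j < V -> e \in L j -> r e = j.
Hypothesis R_starts : forall j e, j < V -> e \in R j -> l e = j.
Hypothesis ends_inj : forall e e', l e = l e' -> r e = r e' -> e = e'.
Hypothesis no_triangle : forall e1 e2 e3,
  l e1 = l e2 -> r e2 = l e3 -> r e3 = r e1 -> False.

Let T := option (E * bool).

Definition head_of (s : seq E) : option E := head None (slab s).
Definition last_of (s : seq E) : option E := last None (map Some s).

Fixpoint links (o : option E) (s : seq (option E)) : seq (T * T) :=
  if s is o' :: s' then (side true o, side false o') :: links o' s' else [::].

Lemma size_links o s : size (links o s) = size s.
Proof. by elim: s o => //= o' s IH o; rewrite IH. Qed.

Lemma linksP (C : eqType) (f : T -> C) o s :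
  (forall p, p \in links o s -> f p.1 = f p.2) -> path (adj_sides f) o s.
Proof.
elim: s o => //= o' s IH o H; rewrite /adj_sides (H _ (mem_head _ _)) eqxx /=.
by apply: IH => p ps; apply: H; rewrite inE ps orbT.
Qed.

(** Only the gaps from the top of [P j] to the bottom of [Q j] are new to the right of vertex [j]:
    one more than there are edges in [R j]. *)
Definition vertex_links (j : nat) : seq (T * T) :=
  links (last_of (P j)) (rcons (map Some (R j)) (head_of (Q j))).

Definition all_links : seq (T * T) := flatten [seq vertex_links j | j <- iota 0 V].

Lemma gaps_ok_cat (C : eqType) (f : T -> C) s1 s2 s3 :
  gaps_ok f (s1 ++ s2 ++ s3) =
  [&& path (adj_sides f) None (map Some s1),
      path (adj_sides f) (last_of s1) (rcons (map Some s2) (head_of s3)) &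
      path (adj_sides f) (head_of s3) (behead (slab s3))].
Proof.
rewrite /gaps_ok /slab !map_cat rcons_cat cat_path; congr (_ && _).
rewrite rcons_cat /head_of /slab.
have -> : rcons (map Some s3) None = head None (rcons (map Some s3) None)
   :: behead (rcons (map Some s3) None) by case: s3.
by rewrite -cat_rcons cat_path last_rcons.
Qed.

(** Induction over the slabs, starting from the empty one on the left. Gaps inside [P j] and inside
    [Q j] are inherited, and the others are links of vertex [j]. *)
Lemma gaps_ok_A (C : eqType) (f : T -> C) :
  (forall p, p \in all_links -> f p.1 = f p.2) -> forall j, j <= V -> gaps_ok f (A j).
Proof.
move=> H; elim=> [|j IH] jV.
  have -> : A 0 = [::] by case: (A 0) (mem_A 0) => // e s /(_ e); rewrite mem_head ltn0.
  by rewrite /gaps_ok /= /adj_sides eqxx.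
have := IH (ltnW jV); rewrite (A_left jV) (A_right jV) !gaps_ok_cat.
case/and3P=> -> _ ->; rewrite andbT; apply: linksP => p pj.
by apply: H; apply/flatten_mapP; exists j; rewrite // mem_iota.
Qed.

(** An edge starts at a single vertex, so the lists [R j] are disjoint; the extra link at each
    vertex accounts for [V]. *)
Lemma size_all_links : size all_links <= #|E| + V.
Proof.
rewrite size_flatten /shape -map_comp.
have -> : sumn [seq (size \o vertex_links) j | j <- iota 0 V]
    = size (flatten [seq R j | j <- iota 0 V]) + V.
  rewrite size_flatten /shape -map_comp -[in X in _ + X](size_iota 0 V).
  elim: (iota 0 V) => //= j s ->.
  by rewrite /vertex_links size_links size_rcons size_map; lia.
rewrite leq_add2r cardE; apply: uniq_leq_size => [|e _]; last exact: mem_enum.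
have RV j : j \in iota 0 V -> j < V by rewrite mem_iota.
elim: (iota 0 V) (iota_uniq 0 V) RV => //= j s IH /andP[js us] RV.
rewrite cat_uniq IH // => [|i si]; last by apply: RV; rewrite inE si orbT.
have jV := RV _ (mem_head _ _).
have := uniq_A j.+1; rewrite (A_right jV) !cat_uniq => /and3P[_ _ /and3P[-> _ _]].
rewrite andbT; apply/hasPn=> e /flatten_mapP[i si ei]; apply/negP=> ej.
have iV : i < V by apply: RV; rewrite inE si orbT.
by rewrite -(R_starts jV ej) (R_starts iV ei) si in js.
Qed.


Definition gap (s : seq E) (b t : E) : Prop := exists s1 s2, s = s1 ++ b :: t :: s2.

Lemma gap_cat s1 s2 b t : gap (s1 ++ s2) b t ->
  [\/ gap s1 b t, gap s2 b t | exists s1' s2', s1 = rcons s1' b /\ s2 = t :: s2'].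
Proof.
case=> u1 [u2]; elim: s1 u1 => [|x s1 IH] [|y u1] /=.
- by move=> ->; constructor 2; exists [::], u2.
- by move=> ->; constructor 2; exists (y :: u1), u2.
- case=> ->; case: s1 {IH} => [|z s1] /=.
    by move=> ->; constructor 3; exists [::], u2.
  by case=> -> _; constructor 1; exists [::], s1.
- case=> -> /IH[[v1 [v2 ->]]|h|[v1 [v2 [-> ->]]]].
  + by constructor 1; exists (y :: v1), v2.
  + by constructor 2.
  + by constructor 3; exists (y :: v1), v2.
Qed.

Lemma gap_catl s1 s2 b t : gap s1 b t -> gap (s1 ++ s2) b t.
Proof. by case=> u1 [u2 ->]; exists u1, (u2 ++ s2); rewrite -catA. Qed.

Lemma gap_catr s1 s2 b t : gap s2 b t -> gap (s1 ++ s2) b t.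
Proof. by case=> u1 [u2 ->]; exists (s1 ++ u1), u2; rewrite -catA. Qed.

Lemma gap_mid s1 s2 b t : gap (rcons s1 b ++ t :: s2) b t.
Proof. by exists s1, s2; rewrite cat_rcons. Qed.

(** * The life of a bounded cell during the sweep *)

Section Bounded.

Variables (C : eqType) (f : T -> C) (q : C).
Hypothesis f_ok : forall j, j <= V -> gaps_ok f (A j).
Hypothesis q_bounded : f None <> q.

Notation up e := (f (Some (e, true)) = q).
Notation dn e := (f (Some (e, false)) = q).

Lemma gap_colour s b t : gaps_ok f s -> gap s b t ->
  f (Some (b, true)) = f (Some (t, false)).
Proof.
move=> ok [s1 [s2 es]]; move: ok; rewrite es /gaps_ok /slab map_cat rcons_cat cat_path /=.
by case/and4P=> _ _ /eqP.
Qed.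

Lemma first_colour s t : gaps_ok f (t :: s) -> dn t -> False.
Proof. by rewrite /gaps_ok /= => /andP[/eqP <-]. Qed.

Lemma last_colour s b : gaps_ok f (rcons s b) -> up b -> False.
Proof.
rewrite /gaps_ok /slab rcons_path map_rcons last_rcons => /andP[_ /eqP /= ->].
exact: q_bounded.
Qed.

Lemma gapA j b t : j <= V -> gap (A j) b t -> (up b <-> dn t).
Proof. by move=> jV /(gap_colour (f_ok jV)) ->. Qed.

Lemma gap_mem s b t : gap s b t -> b \in s /\ t \in s.
Proof. by case=> s1 [s2 ->]; rewrite !mem_cat !inE !eqxx !orbT. Qed.

Lemma memP j e : j < V -> e \in P j -> l e < j /\ j < r e.
Proof.
move=> jV eP; have := mem_A j e; have := mem_A j.+1 e.
rewrite (A_left jV) (A_right jV) !mem_cat eP /= => /esym/andP[_ ->] /esym/andP[-> _].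
by [].
Qed.

Lemma memQ j e : j < V -> e \in Q j -> l e < j /\ j < r e.
Proof.
move=> jV eQ; have := mem_A j e; have := mem_A j.+1 e.
rewrite (A_left jV) (A_right jV) !mem_cat eQ !orbT => /esym/andP[_ ->] /esym/andP[-> _].
by [].
Qed.

(* What can happen at the vertex [j] to the cell between [b] and [t]. In the merges, [w] is
   an edge that ends at [j] and whose other side bounds the cell that absorbs this one. *)
Variant event (j : nat) (b t : E) : Prop :=
| Persist of j < r b & j < r t & gap (A j.+1) b t
| Split e1 e2 of j < r b & j < r t & l e1 = j & l e2 = j & dn e1 & up e2
| TopTurn e of r t = j & j < r b & l e = j & gap (A j.+1) b e
| TopMerge u w of r t = j & j < r b & j < r u & dn u & r w = j & up w
| BotTurn e of r b = j & j < r t & l e = j & gap (A j.+1) e t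
| BotMerge d w of r b = j & j < r t & j < r d & up d & r w = j & dn w
| Close of r b = j & r t = j.

(** Case analysis on the place of the gap in [P j ++ L j ++ Q j], then on whether some edge starts
    at [j]. Boundedness of the class ensures that the neighbours [d] and [u] of a merge exist. *)
Lemma cell_event j b t : j < V -> gap (A j) b t -> up b -> event j b t.
Proof.
move=> jV g ub; have dt : dn t by rewrite -(gapA (ltnW jV) g).
have eL := A_left jV; have eR := A_right jV.
have inP := fun e => @memP j e jV; have inQ := fun e => @memQ j e jV.
have inL := fun e => @L_ends j e jV; have inR := fun e => @R_starts j e jV.
have okL := @gapA j _ _ (ltnW jV); have okR := @gapA j.+1 _ _ jV.
have gokR := f_ok jV.
move: g; rewrite eL => /gap_cat[gP|/gap_cat[gL|gQ|]|].
- have [/inP[_ rb] /inP[_ rt]] := gap_mem gP.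
  by apply: Persist => //; rewrite eR; apply: gap_catl.
- have [/inL rb /inL rt] := gap_mem gL; exact: Close.
- have [/inQ[_ rb] /inQ[_ rt]] := gap_mem gQ.
  by apply: Persist => //; rewrite eR; do 2 apply: gap_catr.
- case=> L' [Q' [EL EQ]].
  have rb : r b = j by apply: inL; rewrite EL mem_rcons mem_head.
  have [_ rt] : l t < j /\ j < r t by apply: inQ; rewrite EQ mem_head.
  case/lastP: (R j) eR inR => [|R' e] eR inR.
    (* Nothing starts at [j]. With nothing below either, [t] would become the lowest edge and the
       class would be that of infinity. *)
    case/lastP: (P j) eR eL inP => [|P' d] eR eL inP.
      by move: gokR; rewrite eR EQ => /first_colour /(_ dt).
    have [_ rd] : l d < j /\ j < r d by apply: inP; rewrite mem_rcons mem_head.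
    have gdt : gap (A j.+1) d t by rewrite eR EQ; apply: gap_mid.
    have ud := (okR _ _ gdt).2 dt.
    have [w [L2 EL2]] : exists w L2, L j = w :: L2.
      by rewrite EL; case: (L') => [|w L2]; [exists b, [::] | exists w, (rcons L2 b)].
    have gdw : gap (A j) d w by rewrite eL EL2; apply: gap_mid.
    apply: (BotMerge (d := d) (w := w)) => //; last exact/(okL _ _ gdw).
    by apply: inL; rewrite EL2 mem_head.
  apply: (BotTurn (e := e)) => //; first by apply: inR; rewrite mem_rcons mem_head.
  by rewrite eR EQ; apply/gap_catr/gap_mid.
case=> P' [s2 [EP]].
have [_ rb] : l b < j /\ j < r b by apply: inP; rewrite EP mem_rcons mem_head.
case: (L j) eL inL => [|t' L'] eL inL /=.
  (* No edge ends at [j], so the vertex lies inside the cell: edges starting there split it, and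
     without any the cell goes on unchanged. *)
  move=> EQ; have [_ rt] : l t < j /\ j < r t by apply: inQ; rewrite EQ mem_head.
  case ER: (R j) eR inR => [|e1 R'] eR inR.
    by apply: Persist => //; rewrite eR EP EQ; apply: gap_mid.
  have g1 : gap (A j.+1) b e1 by rewrite eR EP; apply: gap_mid.
  have [R2 [e2 ER2]] : exists R2 e2, e1 :: R' = rcons R2 e2.
    by case/lastP: R' {ER eR inR g1} => [|R2 e2]; [exists [::], e1 | exists (e1 :: R2), e2].
  have g2 : gap (A j.+1) e2 t by rewrite eR EQ ER2; apply/gap_catr/gap_mid.
  apply: (Split (e1 := e1) (e2 := e2)) => //.
  - by apply: inR; rewrite mem_head.
  - by apply: inR; rewrite ER2 mem_rcons mem_head.
  - exact/(okR _ _ g1).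
  - exact/(okR _ _ g2).
case=> Et Es; subst t'; have rt : r t = j by apply: inL; rewrite mem_head.
case: (R j) eR inR => [|e R'] eR inR.
  case: (Q j) eR eL inQ => [|u Q'] eR eL inQ.
    by move: gokR; rewrite eR EP /= cats0 => /last_colour /(_ ub).
  have [_ ru] : l u < j /\ j < r u by apply: inQ; rewrite mem_head.
  have gbu : gap (A j.+1) b u by rewrite eR EP; apply: gap_mid.
  have du := (okR _ _ gbu).1 ub.
  have [L2 [w EL2]] : exists L2 w, t :: L' = rcons L2 w.
    by case/lastP: L' {eL inL Es} => [|L2 w]; [exists [::], t | exists (t :: L2), w].
  have gwu : gap (A j) w u by rewrite eL EL2; apply/gap_catr/gap_mid.
  apply: (TopMerge (u := u) (w := w)) => //; last exact/(okL _ _ gwu).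
  by apply: inL; rewrite EL2 mem_rcons mem_head.
apply: (TopTurn (e := e)) => //; first by apply: inR; rewrite mem_head.
by rewrite eR EP; apply: gap_mid.
Qed.


Lemma gap_active j b t : gap (A j) b t ->
  [/\ l b < j, j <= r b, l t < j & j <= r t].
Proof. by move=> /gap_mem[]; rewrite !mem_A => /andP[-> ->] /andP[-> ->]. Qed.

(** Before [b] or [t] ends, the cell can only persist or split. A split stops the pursuit, as it
    supplies at once a lower and an upper side that start at [j] or later. *)
Lemma gap_persist j b t : gap (A j) b t -> up b ->
  gap (A (minn (r b) (r t))) b t \/
  exists e1 e2, [/\ j <= l e1, j <= l e2, dn e1 & up e2].
Proof.
move: {2}(minn _ _ - j) (leqnn (minn (r b) (r t) - j)) => k.
elim: k j => [|k IH] j hk g ub; have [h1 h2 h3 h4] := gap_active g.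
  by left; have -> : minn (r b) (r t) = j by lia.
have [->|ne] := eqVneq (minn (r b) (r t)) j; first by left.
have jV : j < V by apply: leq_ltn_trans (r_lt b).
case: (cell_event jV g ub); try by [lia].
- move=> _ _ g'; have [|h|[e1 [e2 [i1 i2 d1 u2]]]] := IH _ _ g' ub; first lia.
    by left.
  by right; exists e1, e2; split=> //; lia.
- by move=> e1 e2 _ _ i1 i2 d1 u2; right; exists e1, e2; rewrite i1 i2.
Qed.

Definition four_sides := exists x1 x2 x3 x4 : T,
  uniq [:: x1; x2; x3; x4] /\ all (fun x => f x == q) [:: x1; x2; x3; x4].

Lemma four_sidesI x1 x2 x3 x4 : uniq [:: x1; x2; x3; x4] ->
  f x1 = q -> f x2 = q -> f x3 = q -> f x4 = q -> four_sides.
Proof. by move=> u h1 h2 h3 h4; exists x1, x2, x3, x4; split; rewrite //= h1 h2 h3 h4 eqxx. Qed.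

Lemma neq_by (g : E -> nat) x y : g x <> g y -> x != y.
Proof. by move=> h; apply/eqP=> e; apply: h; rewrite e. Qed.

Lemma uniq_2up2dn (a b c d : E) : a != b -> c != d ->
  uniq [:: Some (a, true); Some (b, true); Some (c, false); Some (d, false)].
Proof.
move=> ab cd; rewrite /= !inE /eq_op /= /eq_op /= !andbF !andbT !orbF /=.
by rewrite ab cd.
Qed.

Lemma uniq_1up3dn (a c d e : E) : c != d -> c != e -> d != e ->
  uniq [:: Some (a, true); Some (c, false); Some (d, false); Some (e, false)].
Proof.
move=> cd ce de; rewrite /= !inE /eq_op /= /eq_op /= !andbF !andbT !orbF /=.
by rewrite !negb_or cd ce de.
Qed.

Lemma uniq_3up1dn (a b c d : E) : a != b -> a != c -> b != c ->
  uniq [:: Some (a, true); Some (b, true); Some (c, true); Some (d, false)].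
Proof.
move=> ab ac bc; rewrite /= !inE /eq_op /= /eq_op /= !andbF !andbT !orbF /=.
by rewrite !negb_or ab ac bc.
Qed.

(** The upper side of [b] and the lower side of [t] are given. A split or a merge adds two more; a
    turn adds one, and the cell is then followed to its next event, which adds a fourth unless it
    closes a triangle. The sides are told apart by the ends of their edges. *)
Lemma wedge_four_sides p b t : p < V -> gap (A p.+1) b t -> l b = p -> l t = p ->
  up b -> four_sides.
Proof.
move=> pV g lb lt ub.
have dt : dn t by apply/(gapA pV g).
have bt : b <> t.
  move=> E1; case: g (uniq_A p.+1) => s1 [s2 ->]; rewrite E1 cat_uniq /= inE eqxx.
  by rewrite !andbF.
have [gJ|[e1 [e2 [i1 i2 d1 u2]]]] := gap_persist g ub; last first.
  by apply: (four_sidesI (uniq_2up2dn _ _) ub u2 dt d1); apply: (@neq_by l); lia.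
set J := minn _ _ in gJ; have [j1 j2 j3 j4] := gap_active gJ.
have JV : J < V by apply: leq_ltn_trans (r_lt b).
case: (cell_event JV gJ ub); try by [lia].
- move=> e rt rb le ge.
  have de : dn e by apply/(gapA JV ge).
  have [gK|[e1 [e2 [i1 i2 d1 u2]]]] := gap_persist ge ub; last first.
    by apply: (four_sidesI (uniq_2up2dn _ _) ub u2 dt d1); apply: (@neq_by l); lia.
  set K := minn _ _ in gK; have [k1 k2 k3 k4] := gap_active gK.
  have KV : K < V by apply: leq_ltn_trans (r_lt b).
  have te : t != e by apply: (@neq_by l); lia.
  case: (cell_event KV gK ub); try by [lia].
  + move=> e' rK rb' le' ge'.
    have de' : dn e' by apply/(gapA KV ge').
    by apply: (four_sidesI (uniq_1up3dn _ _ _ _) ub dt de de') => //; apply: (@neq_by l); lia.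
  + move=> u w rK rb' ru _ rw uw.
    by apply: (four_sidesI (uniq_2up2dn _ te) ub uw dt de); apply: (@neq_by r); lia.
  + move=> e' rb' rK le' ge'; have ue' : up e' by apply/(gapA KV ge').
    by apply: (four_sidesI (uniq_2up2dn _ te) ub ue' dt de); apply: (@neq_by l); lia.
  + move=> d w rb' rK rd ud _ _.
    by apply: (four_sidesI (uniq_2up2dn _ te) ub ud dt de); apply: (@neq_by r); lia.
  (* Closing after a single turn makes [b], [t] and [e] the sides of a triangle. *)
  + by move=> rb' re'; case: (no_triangle (e1 := b) (e2 := t) (e3 := e)); lia.
- move=> u w rt rb ru du rw uw.
  by apply: (four_sidesI (uniq_2up2dn _ _) ub uw dt du); apply: (@neq_by r); lia.
- move=> e rb rt le ge.
  have ue : up e by apply/(gapA JV ge).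
  have be : b != e by apply: (@neq_by l); lia.
  have [gK|[e1 [e2 [i1 i2 d1 u2]]]] := gap_persist ge ue; last first.
    by apply: (four_sidesI (uniq_2up2dn be _) ub ue dt d1); apply: (@neq_by l); lia.
  set K := minn _ _ in gK; have [k1 k2 k3 k4] := gap_active gK.
  have KV : K < V by apply: leq_ltn_trans (r_lt t).
  case: (cell_event KV gK ue); try by [lia].
  + move=> e' rK rb' le' ge'; have de' : dn e' by apply/(gapA KV ge').
    by apply: (four_sidesI (uniq_2up2dn be _) ub ue dt de'); apply: (@neq_by l); lia.
  + move=> u w rK rb' ru du _ _.
    by apply: (four_sidesI (uniq_2up2dn be _) ub ue dt du); apply: (@neq_by r); lia.
  + move=> e' re' rK le' ge'; have ue' : up e' by apply/(gapA KV ge').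
    by apply: (four_sidesI (uniq_3up1dn _ be _ _) ub ue ue' dt) => //; apply: (@neq_by l); lia.
  + move=> d w re' rK rd _ rw dw.
    by apply: (four_sidesI (uniq_2up2dn be _) ub ue dt dw); apply: (@neq_by r); lia.
  + by move=> re' rK; case: (no_triangle (e1 := t) (e2 := b) (e3 := e)); lia.
- move=> d w rb rt rd ud rw dw.
  by apply: (four_sidesI (uniq_2up2dn _ _) ub ud dt dw); apply: (@neq_by r); lia.
(* Closing without a turn would give [b] and [t] the same two ends. *)
- by move=> rb rt; case: bt; apply: ends_inj; lia.
Qed.

Hypothesis l_lt_r : forall e, l e < r e.

(* The leftmost vertex of a bounded class is the apex of a wedge of the class. *)
Lemma class_four_sides x : f x = q -> four_sides.
Proof.
case: x => [[e0 s0]|/q_bounded//] fx0.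
have col0 : [exists s, f (Some (e0, s)) == q] by apply/existsP; exists s0; apply/eqP.
case: (arg_minnP l (P := fun e => [exists s, f (Some (e, s)) == q]) col0) => e.
case/existsP=> s /eqP fe min_e; set p := l e.
have pV : p < V by apply: ltn_trans (l_lt_r e) (r_lt e).
have min_col e' s' : f (Some (e', s')) = q -> p <= l e'.
  by move=> fe'; apply: min_e; apply/existsP; exists s'; apply/eqP.
have gok := f_ok pV; have inP := fun e => @memP p e pV; have inQ := fun e => @memQ p e pV.
have inR := fun e => @R_starts p e pV; have eR := A_right pV; have okA := @gapA p.+1 _ _ pV.
have eRp : e \in R p.
  have : e \in A p.+1 by rewrite mem_A /p leqnn l_lt_r.
  rewrite eR !mem_cat => /or3P[/inP[]|//|/inQ[]]; rewrite /p; lia.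
have [R1 [R2 ER]] : exists R1 R2, R p = R1 ++ e :: R2.
  by case/splitPr: eRp => R1 R2; exists R1, R2.
case: s fe => fe.
  (* If [e] is the top edge leaving [p], the cell over it is bounded above by an edge of [Q p],
     which starts before [p] against minimality, or by nothing, which makes the class that of
     infinity. *)
  case: R2 ER => [|e2 R2] ER.
    case EQ: (Q p) eR inQ => [|u Q'] eR inQ.
      by move: gok; rewrite eR ER !cats0 cats1 -rcons_cat => /last_colour /(_ fe).
    have g : gap (A p.+1) e u by rewrite eR ER cats1; apply/gap_catr/gap_mid.
    have du := (okA _ _ g).1 fe.
    by have := min_col _ _ du; have [] := inQ _ (mem_head u Q'); lia.
  have g : gap (A p.+1) e e2 by rewrite eR ER; apply/gap_catr/gap_catl; exists R1, R2.
  apply: (wedge_four_sides pV g) => //.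
  by apply: inR; rewrite ER mem_cat !inE eqxx !orbT.
case/lastP: R1 ER => [|R1 e2] ER.
  case/lastP EP: (P p) eR inP => [|P' d] eR inP.
    by move: gok; rewrite eR ER => /first_colour /(_ fe).
  have g : gap (A p.+1) d e by rewrite eR ER; apply/gap_mid.
  have ud := (okA _ _ g).2 fe.
  have [] : l d < p /\ p < r d by apply: inP; rewrite mem_rcons mem_head.
  by have := min_col _ _ ud; lia.
have g : gap (A p.+1) e2 e by rewrite eR ER; apply/gap_catr/gap_catl/gap_mid.
apply: (wedge_four_sides pV g) => //; last exact/(okA _ _ g).
by apply: inR; rewrite ER mem_cat mem_rcons mem_head.
Qed.

End Bounded.

Hypothesis l_lt_r : forall e, l e < r e.

Theorem sweep_edge_bound : #|E| <= 2 * V.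
Proof.
have [f [f_links cardT]] := quotient_by_links all_links.
have f_ok := gaps_ok_A f_links.
have szL := size_all_links.
rewrite card_option card_prod card_bool in cardT.
(* Of the [2 * #|E| + 1] sides, the class of infinity has at least one and each other class at least
   four. *)
have : 1 + 4 * (#|[set f x | x : T]| - 1) <= (#|E| * 2).+1.
  have -> : (#|E| * 2).+1 = \sum_(x : T) 1 by rewrite sum1_card card_option card_prod card_bool.
  rewrite (partition_big_imset f) /= (bigD1 (f None)) ?imset_f //=.
  apply: leq_add; first by rewrite (bigD1 None) //= leq_addr.
  rewrite [X in 4 * (X - _)](cardsD1 (f None)) imset_f //= add1n subn1 /=.
  rewrite mulnC -sum_nat_const big_mkcond [X in _ <= X]big_mkcond.
  apply: leq_sum => y _; rewrite !inE andbC.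
  case: ifP => // /andP[/imsetP[x _ yx] yN].
  have [x1 [x2 [x3 [x4 [u fx]]]]] : four_sides f y.
    by apply: (class_four_sides f_ok _ l_lt_r (x := x)) => // /esym/eqP; rewrite (negPf yN).
  rewrite sum1_card -[4]/(size [:: x1; x2; x3; x4]) -(card_uniqP u).
  by apply: subset_leq_card; apply/subsetP=> z /(allP fx).
by have : #|E| * 2 < #|[set f x | x : T]| + size all_links := cardT; lia.
Qed.

End Sweep.

Import Order.TTheory GRing.Theory Num.Theory.
Local Open Scope ring_scope.

(** * Straight-line drawings *)

Lemma sorted_split3 d (K : orderType d) (T : Type) (k : T -> K) (c : K) (s : seq T) :
  sorted (fun a b => k a <= k b)%O s ->
  s = [seq a <- s | k a < c]%O ++ [seq a <- s | k a == c] ++ [seq a <- s | c < k a]%O.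
Proof.
elim: s => [|a s IH] //= ss.
have le_trans_k : transitive (fun a b : T => k a <= k b)%O by move=> x y z; exact: le_trans.
have all_ge : all (fun b => k a <= k b)%O s by have := order_path_min le_trans_k ss.
have IHs := IH (path_sorted ss).
case: ltgtP => [lt|gt|eq] /=; first by rewrite -IHs.
  have no p : (forall b, k a <= k b -> ~~ p b)%O -> [seq b <- s | p b] = [::].
    move=> h; elim: s all_ge {ss IH IHs} => //= b s IHs /andP[ab /IHs ->].
    by rewrite (negPf (h _ ab)).
  rewrite {1}IHs (no (fun b => k b < c)%O) ?(no (fun b => k b == c)) //= => b ab.
    by rewrite gt_eqF // (lt_le_trans gt).
  by rewrite -leNgt (le_trans (ltW gt)).
have no : [seq b <- s | k b < c]%O = [::].
  elim: s all_ge {ss IH IHs} => //= b s IHs /andP[ab /IHs ->].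
  by rewrite ltNge -eq ab.
by rewrite {1}IHs no.
Qed.

Section Straight.

Variables (K : realFieldType) (m : nat) (X Y : nat -> K).
Variables (E : finType) (l r : E -> nat) (a b : E -> K).

Let h e x := a e + b e * x.

Hypothesis X_mono : forall i j, (i < j < m)%N -> X i < X j.
Hypothesis l_lt_r : forall e, (l e < r e)%N.
Hypothesis r_lt : forall e, (r e < m)%N.
Hypothesis h_r : forall e, h e (X (r e)) = Y (r e).
Hypothesis h_l : forall e, h e (X (l e)) = Y (l e).
Hypothesis avoids_vertices : forall e j, (l e < j < r e)%N -> h e (X j) <> Y j.
Hypothesis no_crossing : forall e f x, e <> f ->
  X (l e) < x < X (r e) -> X (l f) < x < X (r f) -> h e x <> h f x.
Hypothesis ends_inj : forall e e', l e = l e' -> r e = r e' -> e = e'.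
Hypothesis no_triangle : forall e1 e2 e3,
  l e1 = l e2 -> r e2 = l e3 -> r e3 = r e1 -> False.

Lemma X_le i j : (i <= j)%N -> (j < m)%N -> X i <= X j.
Proof.
rewrite leq_eqVlt => /predU1P[->//|ij jm]; apply/ltW/X_mono.
by rewrite ij.
Qed.

(** If the order were reversed at [y], the affine difference [D] would vanish at [z], a proper
    convex combination of [x] and [y]. Since [x] is interior, so is [z], even when [y] is an end of
    the interval. *)
Lemma order_extends e f x y u v : u < x < v -> u <= y <= v ->
  (forall z, u < z < v -> h e z <> h f z) -> h e x < h f x -> h e y <= h f y.
Proof.
move=> /andP[ux xv] /andP[uy yv] nc hx; rewrite leNgt; apply/negP=> hy.
pose D z := h e z - h f z.
have Dx : D x < 0 by rewrite subr_lt0.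
have Dy : 0 < D y by rewrite subr_gt0.
have DD : 0 < D y - D x by rewrite subr_gt0 (lt_trans Dx).
pose t := D y / (D y - D x).
have t0 : 0 < t by rewrite divr_gt0.
have t1 : t < 1 by rewrite ltr_pdivrMr // mul1r ltrBrDr gtrDl.
pose z := t * x + (1 - t) * y.
have Dz : D z = t * D x + (1 - t) * D y by rewrite /D /h /z; ring.
have Dz0 : D z = 0.
  rewrite Dz /t; apply: (mulIf (lt0r_neq0 DD)); rewrite mul0r mulrDl.
  rewrite -!mulrA; field; exact: lt0r_neq0.
apply: (nc z); last by apply/eqP; rewrite -subr_eq0; apply/eqP.
rewrite /z; apply/andP; split; nra.
Qed.

(** Slab [j] lies between the vertices [j - 1] and [j]. Edges do not cross inside it, so their
    heights at one inner point order them on all of it. *)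
Definition mid j := (X j.-1 + X j) / 2%:R.

Definition active j := [seq e <- enum E | (l e < j <= r e)%N].

Definition slab_order j := sort (fun e f => h e (mid j) <= h f (mid j)) (active j).

Lemma mem_slab_order j e : (e \in slab_order j) = (l e < j <= r e)%N.
Proof. by rewrite mem_sort mem_filter mem_enum andbT. Qed.

Lemma uniq_slab_order j : uniq (slab_order j).
Proof. by rewrite sort_uniq filter_uniq // enum_uniq. Qed.

Lemma active_span j e : (l e < j <= r e)%N ->
  [/\ X (l e) <= X j.-1, X j.-1 < mid j, mid j < X j & X j <= X (r e)].
Proof.
move=> /andP[lj jr]; have jm := leq_ltn_trans jr (r_lt e).
have lt : X j.-1 < X j by apply: X_mono; lia.
split; [by apply: X_le; lia | | | exact: X_le]; rewrite /mid; lra.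
Qed.

(** The order is weak because edges may share a vertex at either end of the slab. *)
Lemma slab_sorted j y : X j.-1 <= y <= X j ->
  sorted (fun e f => h e y <= h f y) (slab_order j).
Proof.
move=> hy; have tot : total (fun e f => h e (mid j) <= h f (mid j)) by move=> e f; exact: le_total.
have := sort_sorted tot (active j).
apply: sub_in_sorted (allss (slab_order j)) => e f; rewrite !mem_slab_order => ae af.
have [e1 e2 e3 e4] := active_span ae; have [f1 f2 f3 f4] := active_span af.
have [->//|/eqP ef] := eqVneq e f.
have nc z : X j.-1 < z < X j -> h e z <> h f z.
  by move=> /andP[z1 z2]; apply: no_crossing => //; apply/andP; split; lra.
rewrite le_eqVlt => /predU1P[/nc|]; first by case; rewrite e2 e3.
by apply: order_extends hy nc; rewrite e2 e3.
Qed.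

Definition below j := [seq e <- slab_order j | h e (X j) < Y j].
Definition arriving j := [seq e <- slab_order j | h e (X j) == Y j].
Definition above j := [seq e <- slab_order j | Y j < h e (X j)].
Definition leaving j := [seq e <- slab_order j.+1 | h e (X j) == Y j].

Lemma slab_order_left j : (j < m)%N -> slab_order j = below j ++ arriving j ++ above j.
Proof.
move=> jm; apply: (sorted_split3 (k := fun e => h e (X j))).
by apply: slab_sorted; rewrite lexx X_le // leq_pred.
Qed.

(** An edge that misses vertex [j] is active on both sides of it or on neither. Both lists are
    sorted by height at [X j], where such edges have distinct heights, so they agree. *)
Lemma filter_through j (p : pred E) : (j < m)%N ->
  (forall e, p e -> h e (X j) != Y j) ->
  [seq e <- slab_order j | p e] = [seq e <- slab_order j.+1 | p e].
Proof.
move=> jm hp.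
have thr e i : (i == j) || (i == j.+1) ->
    (e \in [seq e <- slab_order i | p e]) = p e && (l e < j < r e)%N.
  move=> ij; rewrite mem_filter mem_slab_order; case pe: (p e) => //=.
  have := hp _ pe; have [<- | lj] := eqVneq (l e) j; first by rewrite h_l eqxx.
  have [<- | rj] := eqVneq (r e) j; first by rewrite h_r eqxx.
  by move=> _; move: ij; lia.
apply: (@sorted_eq_in _ (fun e f => h e (X j) <= h f (X j))).
- by move=> e f g _ _ _; exact: le_trans.
- move=> e f; rewrite !thr ?eqxx // => /andP[_ le] /andP[_ lf] /le_anti.
  move/eqP; apply: contraTeq => /eqP ef; apply/eqP; apply: no_crossing => //.
    by rewrite !X_mono //; move: (r_lt e); lia.
  by rewrite !X_mono //; move: (r_lt f); lia.
- apply: sorted_filter; first by move=> e f g; exact: le_trans.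
  by apply: slab_sorted; rewrite lexx X_le // leq_pred.
- apply: sorted_filter; first by move=> e f g; exact: le_trans.
  have [j1|j1] := ltnP j.+1 m; first by apply: slab_sorted; rewrite lexx X_le.
  suff -> : slab_order j.+1 = [::] by [].
  case E1 : (slab_order j.+1) (mem_slab_order j.+1) => [//|e s] /(_ e).
  by rewrite mem_head => /esym; have := r_lt e; lia.
- by apply: uniq_perm; rewrite ?filter_uniq ?uniq_slab_order // => e; rewrite !thr ?eqxx ?orbT.
Qed.

Lemma slab_order_right j : (j < m)%N -> slab_order j.+1 = below j ++ leaving j ++ above j.
Proof.
move=> jm; rewrite /below /above (filter_through jm) => [|e /lt_eqF->//].
rewrite (filter_through (p := fun e => Y j < h e (X j)) jm) => [|e /gt_eqF->//].
have [j1|j1] := ltnP j.+1 m.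
  by apply: (sorted_split3 (k := fun e => h e (X j))); apply: slab_sorted; rewrite lexx X_le.
rewrite /leaving; suff -> : slab_order j.+1 = [::] by [].
case E1 : (slab_order j.+1) (mem_slab_order j.+1) => [//|e s] /(_ e).
by rewrite mem_head => /esym; have := r_lt e; lia.
Qed.

Theorem straight_edge_bound : (#|E| <= 2 * m)%N.
Proof.
apply: (sweep_edge_bound mem_slab_order r_lt uniq_slab_order slab_order_left
  slab_order_right _ _ ends_inj no_triangle l_lt_r).
(* An active edge through the vertex must end there, since it meets no vertex in its interior. *)
- move=> j e jm; rewrite mem_filter mem_slab_order => /andP[/eqP hj ae].
  apply/eqP; apply/negPn/negP=> rj; apply: avoids_vertices hj; lia.
- move=> j e jm; rewrite mem_filter mem_slab_order => /andP[/eqP hj ae].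
  apply/eqP; apply/negPn/negP=> rj; apply: avoids_vertices hj; lia.
Qed.

End Straight.

(** * Arrangements of segments *)

Lemma avoid_seq (K : realDomainType) (s : seq K) : exists x, x \notin s.
Proof.
(* Larger than every entry, as each entry is at most the sum of the absolute values. *)
exists (1 + \sum_(y <- s) `|y|); apply/negP=> xs.
have : 1 + \sum_(y <- s) `|y| <= \sum_(y <- s) `|y|.
  rewrite [X in _ <= X](big_rem _ xs) /= ger0_norm ?lerDl ?sumr_ge0 //.
  by rewrite addr_ge0 ?sumr_ge0.
by rewrite gerDr ler10.
Qed.

(** Distinct points of equal second coordinate are separated by every shear; any other pair is
    identified by one value of [eps] only, and finitely many values can be avoided. This is the
    generic sweep direction. *)
Lemma injective_shear (K : realFieldType) (T : finType) (c : T -> K * K) :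
  injective c -> exists eps, injective (fun v => (c v).1 + eps * (c v).2).
Proof.
move=> inj.
have [eps he] := avoid_seq [seq ((c p.1).1 - (c p.2).1) / ((c p.2).2 - (c p.1).2)
                           | p : T * T].
exists eps => u v huv; apply: inj; have [e2|ne2] := eqVneq (c u).2 (c v).2.
  by move: huv e2; case: (c u) (c v) => [x y] [x' y'] /= h e; move: h; rewrite e => /addIr ->.
case/negP: he; apply/mapP; exists (u, v); first by rewrite mem_enum.
have nz : (c v).2 - (c u).2 != 0 by rewrite subr_eq0 eq_sym.
by apply: (mulIf nz); rewrite /= divfK //; move: huv => /= huv; lra.
Qed.

Lemma ratio01 (K : realFieldType) (a x b : K) : a < x -> x < b ->
  0 < (x - a) / (b - a) < 1 /\ x = a + (x - a) / (b - a) * (b - a).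
Proof.
move=> ax xb; have ab : 0 < b - a by rewrite subr_gt0 (lt_trans ax).
have xa : 0 < x - a by rewrite subr_gt0.
split; first by rewrite (divr_gt0 xa ab) (ltr_pdivrMr _ _ ab) mul1r ltrD2r.
by rewrite divfK ?lt0r_neq0 // addrC subrK.
Qed.

Section Consecutive.

Variables (d : Order.disp_t) (K : orderType d) (T : eqType) (k : T -> K).

Definition consecutive (s : seq T) : seq (T * T) := zip s (behead s).

Lemma size_consecutive s : size (consecutive s) = (size s).-1.
Proof. by rewrite size_zip size_behead; apply/minn_idPr/leq_pred. Qed.

Lemma consecutiveP s u v : sorted (fun a b => k a < k b)%O s -> (u, v) \in consecutive s ->
  [/\ u \in s, v \in s, (k u < k v)%O & forall w, w \in s -> ((k w <= k u) || (k v <= k w))%O].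
Proof.
elim: s => [|a [|a' s] IH] //= /andP[aa' ss]; rewrite inE => /predU1P[[-> ->]|h].
  split; rewrite ?inE ?eqxx ?orbT // => w; rewrite !inE => /or3P[/eqP->|/eqP->|ws].
  - by rewrite lexx.
  - by rewrite lexx orbT.
  have tr : transitive (fun a b : T => k a < k b)%O by move=> x y z; exact: lt_trans.
  by have := allP (order_path_min tr ss) _ ws => /ltW ->; rewrite orbT.
have [us vs uv H] := IH ss h.
split=> //; [by apply/orP; right | by rewrite in_cons; apply/orP; right |].
move=> w; rewrite inE => /predU1P[->|/H//]; apply/orP; left.
move: us; rewrite inE => /predU1P[->|us]; first exact: ltW.
have tr : transitive (fun a b : T => k a < k b)%O by move=> x y z; exact: lt_trans.
by apply: ltW; apply: lt_trans aa' _; have := allP (order_path_min tr ss) _ us.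
Qed.

Lemma uniq_consecutive s : uniq s -> uniq (consecutive s).
Proof. by move=> us; apply: zip_uniql. Qed.

End Consecutive.

Lemma uniq_flatten_map (I T : eqType) (F : I -> seq T) (s : seq I) : uniq s ->
  (forall i, uniq (F i)) -> (forall i j x, x \in F i -> x \in F j -> i = j) ->
  uniq (flatten [seq F i | i <- s]).
Proof.
move=> us uF dis; elim: s us => //= i s IH /andP[is_ us].
rewrite cat_uniq uF IH //= andbT; apply/hasPn=> x /flatten_mapP[j js xj].
by apply/negP=> xi; rewrite (dis _ _ _ xi xj) js in is_.
Qed.

Section Arrangement.

Variables (R : realType) (n : nat) (S : 'I_n -> segment R).
Hypothesis S_nondeg : segs_nondegenerate S.
Hypothesis S_meet : pairwise_at_most_one_point S.
Variables (N : nat) (c : 'I_N -> point R) (L : 'I_n -> seq 'I_N).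
Hypothesis encL : valid_encoding S c L.

Lemma c_inj : injective c. Proof. by case: encL. Qed.

Lemma c_vertex v : arr_vertex S (c v).
Proof. by case: encL => _ h _; apply/h; exists v. Qed.

Lemma vertex_c x : arr_vertex S x -> exists v, c v = x.
Proof. by case: encL => _ h _ /h. Qed.

Lemma mem_L i v : v \in L i <-> on_seg (c v) (S i).
Proof. by case: encL => _ _ /(_ i)[]. Qed.

Lemma uniq_L i : uniq (L i).
Proof. by case: encL => _ _ /(_ i)[]. Qed.

(* The parameter of the orthogonal projection of [x] on the line of [S i]. *)
Definition param i (x : point R) : R :=
  ((x.1 - (S i).1.1) * ((S i).2.1 - (S i).1.1) + (x.2 - (S i).1.2) * ((S i).2.2 - (S i).1.2))
  / (((S i).2.1 - (S i).1.1) ^+ 2 + ((S i).2.2 - (S i).1.2) ^+ 2).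

Lemma param_seg i t : param i (seg_param (S i) t) = t.
Proof.
rewrite /param /seg_param; have := S_nondeg i; case: (S i) => [[x y] [x' y']] /= ne.
have nz : (x' - x) ^+ 2 + (y' - y) ^+ 2 != 0.
  rewrite paddr_eq0 ?sqr_ge0 // !sqrf_eq0 !subr_eq0.
  by apply: contra ne => /andP[/eqP-> /eqP->].
by apply: (mulIf nz); rewrite divfK //; ring.
Qed.

Lemma on_segP i x : on_seg x (S i) -> 0 <= param i x <= 1 /\ x = seg_param (S i) (param i x).
Proof. by case=> t [t01 ->]; rewrite param_seg. Qed.

Definition par i v := param i (c v).

Lemma par_inj i u v : u \in L i -> v \in L i -> par i u = par i v -> u = v.
Proof.
move=> /mem_L/on_segP[_ eu] /mem_L/on_segP[_ ev] e; apply: c_inj.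
by rewrite eu ev; congr (seg_param _ _).
Qed.

Lemma sorted_par i : sorted (fun a b => par i a < par i b) (L i).
Proof.
case: encL => _ _ /(_ i)[_ _]; apply: sub_sorted => a b /asboolP[t [u [_ tu _ ea eb]]].
by rewrite /par ea eb !param_seg.
Qed.

Lemma two_segments i j u v : i != j -> u \in L i -> v \in L i -> u \in L j -> v \in L j -> u = v.
Proof.
move=> ij /mem_L ui /mem_L vi /mem_L uj /mem_L vj; apply: c_inj; exact: S_meet ij _ _ ui uj vi vj.
Qed.

Definition pt (x y : point R) (t : R) : point R :=
  (x.1 + t * (y.1 - x.1), x.2 + t * (y.2 - x.2)).

Lemma pt_on_seg i u v t : u \in L i -> v \in L i -> 0 <= t <= 1 ->
  on_seg (pt (c u) (c v) t) (S i) /\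
  param i (pt (c u) (c v) t) = par i u + t * (par i v - par i u).
Proof.
move=> /mem_L/on_segP[u01 eu] /mem_L/on_segP[v01 ev] t01.
have -> : pt (c u) (c v) t = seg_param (S i) (par i u + t * (par i v - par i u)).
  rewrite {1}eu {1}ev /pt /seg_param /= -!/(par _ _); congr (_, _); ring.
rewrite param_seg; split=> //; exists (par i u + t * (par i v - par i u)); split=> //.
by move: u01 v01 t01; rewrite -!/(par _ _) => /andP[? ?] /andP[? ?] /andP[? ?]; apply/andP; split; nra.
Qed.

(** * Consecutive selected vertices and the planar edge bound *)

Section Sublist.

Variable W : {set 'I_N}.
(** Two choices of [W] are made later: the vertices on at least two segments, for the planar bound,
    and all vertices, to count the edges of [G(S)]. *)
Hypothesis W_inner : forall i v, v \in L i -> v \notin W -> c v = (S i).1 \/ c v = (S i).2.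

Definition sub_L i := [seq v <- L i | v \in W].

Definition sub_pairs := flatten [seq consecutive (sub_L i) | i <- enum 'I_n].

Lemma mem_sub_L i v : (v \in sub_L i) = (v \in W) && (v \in L i).
Proof. by rewrite mem_filter. Qed.

(** Expressed through the open interval between the two parameters, which keeps the notion symmetric
    when pairs are reoriented. *)
Definition neighbours i u v := [/\ u \in sub_L i, v \in sub_L i, u != v &
  forall w t, w \in sub_L i -> 0 < t < 1 -> par i w <> par i u + t * (par i v - par i u)].

Lemma neighbours_sym i u v : neighbours i u v -> neighbours i v u.
Proof.
case=> us vs uv H; split=> //; first by rewrite eq_sym.
move=> w t ws /andP[t0 t1] e; apply: (H w (1 - t) ws); last by rewrite e; ring.
by apply/andP; split; lra.
Qed.

Lemma consecutive_neighbours i u v : (u, v) \in consecutive (sub_L i) ->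
  neighbours i u v /\ par i u < par i v.
Proof.
have tr : transitive (fun a b => par i a < par i b) by move=> x y z; exact: lt_trans.
move=> /(consecutiveP (sorted_filter tr _ (sorted_par i)))[us vs uv H]; split=> //.
split=> //; first by apply: contraTneq uv => ->; rewrite ltxx.
move=> w t /H /orP[|] h /andP[t0 t1] e; nra.
Qed.

(** A vertex strictly between would either lie in [W], against consecutiveness, or be an endpoint of
    the segment, whose parameter 0 or 1 is not strictly between. *)
Lemma neighbours_arr_edge i u v : neighbours i u v -> arr_edge S (c u) (c v).
Proof.
case; rewrite !mem_sub_L => /andP[uW uL] /andP[vW vL] uv H.
split; [by move/c_inj/eqP; apply/negP | exact: c_vertex | exact: c_vertex |].
exists i; split; [exact/mem_L | exact/mem_L |].
case=> z [/vertex_c[w <-] wu wv [t [/andP[t0 t1] ew]]].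
have {}ew : c w = pt (c u) (c v) t by [].
have t0' : 0 < t.
  rewrite lt_neqAle t0 andbT; apply/eqP=> e; apply: wu; rewrite ew -e /pt !mul0r !addr0.
  by case: (c u).
have t1' : t < 1.
  rewrite lt_neqAle t1 andbT; apply/eqP=> e; apply: wv; rewrite ew e /pt !mul1r.
  by rewrite ![_ + (_ - _)]addrC !subrK; case: (c v).
have [] := pt_on_seg uL vL (t := t); first by rewrite t0.
rewrite -ew => /mem_L wL pw; have [wW|wW] := boolP (w \in W).
  by apply: (H w t) => //; [rewrite mem_sub_L wW | rewrite t0'].
have [/mem_L/on_segP[]] := (uL); rewrite -/(par i u) => /andP[u0 u1] _.
have [/mem_L/on_segP[]] := (vL); rewrite -/(par i v) => /andP[v0 v1] _.
have uv' : par i u != par i v by apply: contra uv => /eqP/(par_inj uL vL)->.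
have : 0 < param i (c w) < 1.
  by rewrite pw; case: (ltgtP (par i u) (par i v)) uv' => // uv' _; apply/andP; split; nra.
have p0 : param i (S i).1 = 0.
  by rewrite -[RHS](param_seg i 0) /seg_param !mul0r !addr0; case: ((S i).1).
have p1 : param i (S i).2 = 1.
  rewrite -[RHS](param_seg i 1) /seg_param !mul1r; congr (param _ _).
  by case: (S i) => -[x y] [x' y'] /=; congr (_, _); ring.
by case: (W_inner wL wW) => ->; rewrite ?p0 ?p1 ltxx ?andbF.
Qed.

Lemma mem_sub_pairs p : p \in sub_pairs ->
  exists i, neighbours i p.1 p.2 /\ par i p.1 < par i p.2.
Proof.
case: p => u v /flatten_mapP[i _ /consecutive_neighbours h]; by exists i.
Qed.

Lemma size_sub_pairs : size sub_pairs = (\sum_i (size (sub_L i)).-1)%N.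
Proof.
rewrite size_flatten /shape -map_comp sumnE big_map enumT.
by apply: eq_bigr => i _; rewrite /= size_consecutive.
Qed.

Definition orient (o : rel 'I_N) (p : 'I_N * 'I_N) := if o p.1 p.2 then p else (p.2, p.1).

(** Distinct segments share at most one point; hence no pair is listed for two segments. *)
Lemma neighbours_segment i j u v : neighbours i u v -> neighbours j u v -> i = j.
Proof.
case; rewrite !mem_sub_L => /andP[_ ui] /andP[_ vi] uv _.
case; rewrite !mem_sub_L => /andP[_ uj] /andP[_ vj] _ _.
by apply/eqP; apply: contraNT uv => ij; apply/eqP/(two_segments ij).
Qed.

Lemma uniq_orient_sub_pairs o : uniq [seq orient o p | p <- sub_pairs].
Proof.
rewrite map_inj_in_uniq.
  apply: uniq_flatten_map => [|i|i j [u v]]; first exact: enum_uniq.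
    by apply: uniq_consecutive; rewrite filter_uniq // uniq_L.
  by move=> /consecutive_neighbours[h _] /consecutive_neighbours[h' _]; exact: neighbours_segment h h'.
move=> [u v] [u' v'] /mem_sub_pairs[i /= [h lt]] /mem_sub_pairs[j /= [h' lt']].
rewrite /orient /=; case: ifP => _; case: ifP => _ [e1 e2]; rewrite -?e1 -?e2 //.
- move: h' lt'; rewrite -e1 -e2 => /neighbours_sym h'.
  by rewrite -(neighbours_segment h h') => /(lt_trans lt); rewrite ltxx.
- move: h' lt'; rewrite -e1 -e2 => /neighbours_sym h'.
  by rewrite -(neighbours_segment h h') => /(lt_trans lt); rewrite ltxx.
Qed.


Lemma orientP o p : total o -> orient o p = p \/ orient o p = (p.2, p.1).
Proof. by rewrite /orient; case: ifP; [left | right]. Qed.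

Hypothesis S_tri : arr_triangle_free S.
Hypothesis W_meet : forall i j v, i != j -> v \in L i -> v \in L j -> v \in W.

(* The 1-dimensional case of the non-crossing property. *)
Lemma neighbours_overlap i u v u' v' t t' : neighbours i u v -> neighbours i u' v' ->
  par i u < par i v -> par i u' < par i v' -> 0 < t < 1 -> 0 < t' < 1 ->
  par i u + t * (par i v - par i u) = par i u' + t' * (par i v' - par i u') ->
  u = u' /\ v = v'.
Proof.
have inside a b w : neighbours i a b -> w \in sub_L i -> par i a < par i w -> par i w < par i b -> False.
  case=> _ _ _ H ws aw wb; have [t0 e] := ratio01 aw wb; exact: H ws t0 e.
move=> h h' lt lt' /andP[t0 t1] /andP[t0' t1'] e.
have [us vs _ _] := h; have [us' vs' _ _] := h'.
have uL x : x \in sub_L i -> x \in L i by rewrite mem_sub_L => /andP[].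
have a1 : par i u < par i v' by nra.
have a2 : par i u' < par i v by nra.
split; apply: (@par_inj i); rewrite ?uL //.
  case: (ltgtP (par i u) (par i u')) => // lt1.
    by case: (inside u v u') => //; exact: h.
  by case: (inside u' v' u) => //; exact: h'.
case: (ltgtP (par i v) (par i v')) => // lt1.
  by case: (inside u' v' v) => //; exact: h'.
by case: (inside u v v') => //; exact: h.
Qed.

Lemma sub_pairs_bound : (size sub_pairs <= 2 * #|W|)%N.
Proof.
have [eps shear_inj] := injective_shear c_inj.
pose X v := (c v).1 + eps * (c v).2; pose Y v := (c v).2.
pose o : rel 'I_N := fun a b => X a <= X b.
have o_total : total o by move=> a b; exact: le_total.
have o_tr : transitive o by move=> a b d; exact: le_trans.
(* The vertices of [W] are numbered by their rank along the sheared abscissa. *)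
pose ws := sort o (enum W).
have ws_uniq : uniq ws by rewrite sort_uniq enum_uniq.
have mem_ws v : (v \in ws) = (v \in W) by rewrite mem_sort mem_enum.
have ws_size : size ws = #|W| by rewrite size_sort cardE.
pose rk v := index v ws.
pose XX j := nth 0 (map X ws) j; pose YY j := nth 0 (map Y ws) j.
have XX_rk v : v \in W -> XX (rk v) = X v.
  by move=> vW; rewrite /XX (nth_map v) ?index_mem ?mem_ws // nth_index ?mem_ws.
have YY_rk v : v \in W -> YY (rk v) = Y v.
  by move=> vW; rewrite /YY (nth_map v) ?index_mem ?mem_ws // nth_index ?mem_ws.
have rk_lt v : v \in W -> (rk v < #|W|)%N by rewrite -ws_size index_mem mem_ws.
have rkP j : (j < #|W|)%N -> exists2 v, v \in W & rk v = j.
  rewrite -ws_size => jm; have [v0 _] : exists v0, v0 \in ws.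
    by case: (ws) jm => // v0 s _; exists v0; rewrite mem_head.
  by exists (nth v0 ws j); [rewrite -mem_ws mem_nth | exact: index_uniq].
have rk_mono u v : u \in W -> v \in W -> X u < X v -> (rk u < rk v)%N.
  move=> uW vW uv; rewrite ltnNge; apply: contraL uv => vu; rewrite -leNgt.
  have := sorted_leq_nth o_tr (fun x => lexx _) u (sort_sorted o_total (enum W)).
  move=> /(_ (rk v) (rk u)); rewrite !inE ws_size !rk_lt // => /(_ isT isT vu).
  by rewrite -/ws !nth_index ?mem_ws.
have XX_mono i j : (i < j < #|W|)%N -> XX i < XX j.
  case/andP=> ij jm; have [u uW eu] := rkP _ (ltn_trans ij jm).
  have [v vW ev] := rkP _ jm; rewrite -eu -ev !XX_rk //.
  case: (ltgtP (X u) (X v)) => // [/rk_mono|/shear_inj uv].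
    by rewrite eu ev => /(_ vW uW); rewrite ltnNge (ltnW ij).
  by rewrite -eu -ev uv ltnn in ij.
pose E := seq_sub [seq orient o p | p <- sub_pairs].
have -> : size sub_pairs = #|{: E}|.
  by rewrite card_seq_sub ?uniq_orient_sub_pairs // size_map.
pose lo (e : E) := (val e).1; pose hi (e : E) := (val e).2.
have E_neighbours e : exists i, neighbours i (lo e) (hi e).
  have /mapP[p /mem_sub_pairs[i [h _]] ep] := valP e; exists i.
  by rewrite /lo /hi ep; case: (orientP p o_total) => ->; last exact: neighbours_sym.
have loW e : lo e \in W by have [i []] := E_neighbours e; rewrite mem_sub_L => /andP[].
have hiW e : hi e \in W by have [i [_]] := E_neighbours e; rewrite mem_sub_L => /andP[].
have lo_hi e : X (lo e) < X (hi e).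
  rewrite lt_neqAle; apply/andP; split.
    by apply/negP=> /eqP/shear_inj; have [i [_ _ /eqP]] := E_neighbours e.
  have /mapP[p _ ep] := valP e; rewrite /lo /hi ep /orient.
  by case: ifP => //= /negbT; rewrite /o -ltNge => /ltW.
have E_inj e e' : lo e = lo e' -> hi e = hi e' -> e = e'.
  by rewrite /lo /hi => h1 h2; apply: val_inj; rewrite [LHS]surjective_pairing h1 h2 -surjective_pairing.
pose b e := (Y (hi e) - Y (lo e)) / (X (hi e) - X (lo e)).
pose a e := Y (lo e) - b e * X (lo e).
have nz e : X (hi e) - X (lo e) != 0 by rewrite subr_eq0 gt_eqF.
(* The shear is undone here: sheared abscissa [x] and height [y] belong to the point
   [(x - eps * y, y)]. *)
have h_pt e x : let t := (x - X (lo e)) / (X (hi e) - X (lo e)) in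
    pt (c (lo e)) (c (hi e)) t = (x - eps * (a e + b e * x), a e + b e * x).
  by rewrite /pt /a /b /X /Y; congr (_, _); field; exact: nz.
have t01 e x : X (lo e) < x < X (hi e) ->
    0 < (x - X (lo e)) / (X (hi e) - X (lo e)) < 1.
  by case/andP=> h1 h2; have [] := ratio01 h1 h2.
have rk_inj u v : u \in W -> v \in W -> rk u = rk v -> u = v.
  by move=> uW vW h; apply: shear_inj; rewrite -/(X u) -/(X v) -!XX_rk // h.
have E_edge e : arr_edge S (c (lo e)) (c (hi e)).
  by have [i h] := E_neighbours e; exact: neighbours_arr_edge h.
have no_vertex e x w : X (lo e) < x < X (hi e) -> w \in W ->
    c w <> (x - eps * (a e + b e * x), a e + b e * x).
  move=> hx wW; rewrite -h_pt /=; set t := _ / _ => ew.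
  have [i [us vs _ H]] := E_neighbours e.
  move: us vs; rewrite !mem_sub_L => /andP[_ uL] /andP[_ vL].
  have tI := t01 _ _ hx; rewrite -/t in tI.
  have [] := pt_on_seg uL vL (t := t); first by case/andP: tI => /ltW-> /ltW->.
  rewrite -ew => /mem_L wL; apply: H => //.
  by rewrite mem_sub_L wW.
have oriented e i x : neighbours i (lo e) (hi e) -> X (lo e) < x < X (hi e) ->
    exists u v t, [/\ neighbours i u v, par i u < par i v, 0 < t < 1,
      (u, v) = (lo e, hi e) \/ (v, u) = (lo e, hi e) &
      par i u + t * (par i v - par i u)
        = param i (x - eps * (a e + b e * x), a e + b e * x)
      /\ on_seg (x - eps * (a e + b e * x), a e + b e * x) (S i)].
  move=> h hx; rewrite -h_pt /=; set t := _ / _.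
  have [us vs uv _] := h.
  move: us vs; rewrite !mem_sub_L => /andP[_ uL] /andP[_ vL].
  have tI := t01 _ _ hx; rewrite -/t in tI; have /andP[t0 t1] := tI.
  have [on ep] := pt_on_seg uL vL (t := t) (introT andP (conj (ltW t0) (ltW t1))).
  case: (ltgtP (par i (lo e)) (par i (hi e))) => [lt|gt|/(par_inj uL vL) e1].
  - by exists (lo e), (hi e), t; split=> //; left.
  - exists (hi e), (lo e), (1 - t); split=> //; first exact: neighbours_sym.
    + by apply/andP; split; lra.
    + by right.
    + by split=> //; rewrite ep; ring.
  - by rewrite e1 eqxx in uv.
apply: (straight_edge_bound (X := XX) (Y := YY) (l := fun e => rk (lo e))
   (r := fun e => rk (hi e)) (a := a) (b := b)) => //.
- by move=> e; apply: rk_mono.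
- by move=> e; apply: rk_lt.
- by move=> e; rewrite XX_rk // YY_rk // /a /b; field; exact: nz.
- by move=> e; rewrite XX_rk // YY_rk // /a; ring.
- move=> e j /andP[j1 j2] ej; have [w wW ew] := rkP _ (ltn_trans j2 (rk_lt _ (hiW e))).
  have hx : X (lo e) < X w < X (hi e).
    by rewrite -!XX_rk // !XX_mono // ew ?j1 ?j2 ?rk_lt //= (ltn_trans j2) ?rk_lt.
  apply: (no_vertex _ _ _ hx wW).
  move: ej; rewrite -ew XX_rk // YY_rk // => ->.
  by rewrite /X /Y addrK -surjective_pairing.
- move=> e f x ef; rewrite !XX_rk // => hx hx' eh; apply: ef.
  have [i h] := E_neighbours e; have [k h'] := E_neighbours f.
  have [u [v [t [nb lt tI uv [ep on]]]]] := oriented _ _ _ h hx.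
  have [u' [v' [t' [nb' lt' tI' uv' [ep' on']]]]] := oriented _ _ _ h' hx'.
  rewrite -eh in ep' on'.
  (* On a common segment, overlapping consecutive pairs coincide. On two segments, the common point
     is a vertex of the arrangement that belongs to [W], and no edge has such a vertex in its
     interior. *)
  have [ik|ik] := eqVneq i k.
    subst k; rewrite -ep in ep'.
    have [eu ev] := neighbours_overlap nb nb' lt lt' tI tI' (esym ep').
    subst u' v'; case: uv => [[e1 e2]|[e1 e2]]; case: uv' => [[e1' e2']|[e1' e2']];
      try by [apply: E_inj; congruence].
    + by have := lo_hi e; have := lo_hi f; rewrite -e1 -e2 -e1' -e2' => /ltW; rewrite leNgt => /negPf->.
    + by have := lo_hi e; have := lo_hi f; rewrite -e1 -e2 -e1' -e2' => /ltW; rewrite leNgt => /negPf->.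
  have [w ew] : exists w, c w = (x - eps * (a e + b e * x), a e + b e * x).
    by apply: vertex_c; right; exists i, k.
  case: (no_vertex _ _ w hx) => //.
  by apply: (W_meet ik); apply/mem_L; rewrite ew.
- by move=> e e' h1 h2; apply: E_inj; apply: rk_inj.
- move=> e1 e2 e3 h1 h2 h3.
  have E1 := rk_inj _ _ (loW _) (loW _) h1.
  have E2 := rk_inj _ _ (hiW _) (loW _) h2.
  have E3 := rk_inj _ _ (hiW _) (hiW _) h3.
  have := E_edge e1; have := E_edge e2; have := E_edge e3.
  rewrite E1 E2 E3 => a3 a2 a1; apply: (S_tri a2 a3).
  (* The triangle is closed by [e1] run backwards, so a parameter [s] on it becomes [1 - s]. *)
  have [q1 q2 q3 [i [q4 q5 q6]]] := a1; split=> //; first exact/nesym.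
  exists i; split=> // -[z [z1 z2 z3 z4]]; apply: q6; exists z; split=> //.
  case: z4 => s [s01 ->]; exists (1 - s); split; first by apply/andP; split; lra.
  by rewrite /seg_param /=; congr (_, _); ring.
Qed.

End Sublist.

End Arrangement.

(** * The approximation ratio *)

Lemma sum_const_seq (T : Type) (s : seq T) (k : nat) : (\sum_(x <- s) k = k * size s)%N.
Proof. by rewrite big_const_seq count_predT iter_addn_0. Qed.

Section Approximation.

Local Open Scope nat_scope.

Variables (R : realType) (n : nat) (S : 'I_n -> segment R).
Hypothesis S_nondeg : segs_nondegenerate S.
Hypothesis S_meet : pairwise_at_most_one_point S.
Hypothesis S_tri : arr_triangle_free S.
Variables (N : nat) (c : 'I_N -> point R) (L : 'I_n -> seq 'I_N).
Hypothesis encL : valid_encoding S c L.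

Let c_inj := c_inj encL.
Let mem_L := mem_L encL.
Let uniq_L := uniq_L encL.

Lemma start_on_seg i : on_seg (S i).1 (S i).
Proof.
exists 0%R; split; first by rewrite lexx ler01.
by rewrite /seg_param !mul0r !addr0; case: ((S i).1).
Qed.

Lemma end_on_seg i : on_seg (S i).2 (S i).
Proof.
exists 1%R; split; first by rewrite lexx ler01.
by rewrite /seg_param !mul1r ![(_ + (_ - _))%R]addrC !subrK; case: ((S i).2).
Qed.

Definition deg (v : 'I_N) := #|[set i | v \in L i]|.

Definition crossings : {set 'I_N} := [set v | 1 < deg v].

Lemma crossings_meet i j v : i != j -> v \in L i -> v \in L j -> v \in crossings.
Proof.
move=> ij vi vj; rewrite inE /deg (cardsD1 i) inE vi /= add1n ltnS card_gt0.
by apply/set0Pn; exists j; rewrite !inE eq_sym ij.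
Qed.

(** A vertex on a single segment is no intersection point, so it is an endpoint, necessarily of that
    segment. *)
Lemma crossings_inner i v : v \in L i -> v \notin crossings -> c v = (S i).1 \/ c v = (S i).2.
Proof.
move=> vi vW; have only j : on_seg (c v) (S j) -> j = i.
  move=> /mem_L vj; apply/eqP; apply: contraNT vW => ji; exact: crossings_meet ji vj vi.
case: (c_vertex encL v) => [[k hk]|[j [k [jk [hj hk]]]]]; last first.
  by rewrite (only j) // (only k) // eqxx in jk.
by rewrite -(only k) //; case: hk => ->; [exact: start_on_seg | exact: end_on_seg].
Qed.

Lemma sum_size_sub_L W : \sum_i size (sub_L L W i) = \sum_(v in W) deg v.
Proof.
transitivity (\sum_i \sum_(v in W) (v \in L i : nat)).
  apply: eq_bigr => i _; rewrite -(card_uniqP _) ?filter_uniq //.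
  rewrite -sum1_card big_mkcond [RHS]big_mkcond; apply: eq_bigr => v _.
  by rewrite mem_sub_L; case: (v \in W) => //=; case: (v \in L i).
rewrite exchange_big; apply: eq_bigr => v _.
by rewrite /deg -sum1_card [RHS]big_mkcond; apply: eq_bigr => i _; rewrite inE; case: (v \in L i).
Qed.

Lemma sum_crossings : \sum_(v in crossings) (deg v - 2) <= n.
Proof.
have := sub_pairs_bound S_nondeg S_meet encL crossings_inner S_tri crossings_meet.
rewrite size_sub_pairs => bound.
(* A list of [k] crossings yields [k.-1] pairs; the form [k <= k.-1 + 1] also covers a segment
   without crossings. *)
have h1 : \sum_i size (sub_L L crossings i) <= \sum_i ((size (sub_L L crossings i)).-1 + 1).
  by apply: leq_sum => i _; lia.
rewrite sum_size_sub_L big_split /= sum1_card card_ord in h1.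
have h2 : \sum_(v in crossings) deg v = \sum_(v in crossings) (deg v - 2) + #|crossings| * 2.
  rewrite -sum_nat_const -big_split; apply: eq_bigr => v; rewrite inE => dv /=.
  by rewrite subnK.
move: bound h1; rewrite h2; move: (\sum_i _) (\sum_(v in _) (_ - _)) => x y; lia.
Qed.

Let Ls := [seq map val (L i) | i <- enum 'I_n].

Lemma size_Ls : size Ls = n.
Proof. by rewrite size_map size_enum_ord. Qed.

Lemma nth_Ls (i : 'I_n) : nth [::] Ls i = map val (L i).
Proof. by rewrite (nth_map i) ?size_enum_ord // nth_ord_enum. Qed.

Lemma mem_adj_ord (i : 'I_n) (v : 'I_N) : (val i \in adj Ls (val v)) = (v \in L i).
Proof.
by rewrite mem_adj size_Ls ltn_ord nth_Ls mem_map //; exact: val_inj.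
Qed.

Lemma Ls_lt : all (all (fun v => v < N)) Ls.
Proof. by rewrite all_map; apply/allP=> i _ /=; rewrite all_map; apply/allP=> v _ /=. Qed.

Lemma Ls_uniq : all uniq Ls.
Proof.
rewrite all_map; apply/allP=> i _ /=; rewrite map_inj_uniq //; exact: val_inj.
Qed.

Lemma encodeE : encode L = N :: size Ls :: flat Ls.
Proof.
rewrite /encode size_Ls /flat /Ls -[in RHS]map_comp; congr (_ :: _ :: flatten _).
by apply: eq_map => i /=; rewrite size_map.
Qed.

Lemma sum_size_Ls : \sum_(l <- Ls) size l = \sum_i size (L i).
Proof. by rewrite big_map big_enum /=; apply: eq_bigr => i _; rewrite size_map. Qed.

Lemma count_adj (p : pred nat) (v : 'I_N) :
  count p (adj Ls v) = #|[set i : 'I_n | p i && (v \in L i)]|.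
Proof.
rewrite -size_filter [RHS]cardE -(size_map val); apply/perm_size/uniq_perm.
- by rewrite filter_uniq // uniq_adj // Ls_uniq.
- by rewrite map_inj_uniq ?enum_uniq //; exact: val_inj.
move=> k; rewrite mem_filter; apply/andP/mapP.
  case=> pk kv; have := adj_lt kv; rewrite size_Ls => kn.
  exists (Ordinal kn) => //; rewrite mem_enum inE /= pk /=.
  by rewrite -mem_adj_ord.
case=> i; rewrite mem_enum inE => /andP[pi vi] ->; split=> //.
by rewrite mem_adj_ord.
Qed.

Lemma residualE out (v : 'I_N) :
  residual Ls out v = #|[set i : 'I_n | ~~ hit Ls out i && (v \in L i)]|.
Proof. exact: count_adj. Qed.

Lemma size_adj (v : 'I_N) : size (adj Ls v) = deg v.
Proof. by rewrite -count_predT count_adj; apply: eq_card => i; rewrite !inE. Qed.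

Lemma nunhitE out : nunhit Ls out = #|[set i : 'I_n | ~~ hit Ls out i]|.
Proof.
rewrite /nunhit size_Ls -val_enum_ord count_map -size_filter cardE; congr size.
by rewrite enumT; apply: eq_filter => i; rewrite /= ?inE.
Qed.

Lemma two_le_size_L i : 1 < size (L i).
Proof.
have v1 : arr_vertex S (S i).1 by left; exists i; left.
have v2 : arr_vertex S (S i).2 by left; exists i; right.
have [u eu] := vertex_c encL v1; have [v ev] := vertex_c encL v2.
have uL : u \in L i by apply/mem_L; rewrite eu; exact: start_on_seg.
have vL : v \in L i by apply/mem_L; rewrite ev; exact: end_on_seg.
have uv : u != v by apply: contraNneq (S_nondeg i) => uv; rewrite -eu -ev uv.
have us : uniq [:: u; v] by rewrite /= inE uv.
by apply: (uniq_leq_size us) => w; rewrite !inE => /orP[/eqP->|/eqP->].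
Qed.

(** With [W] all vertices, consecutive pairs are edges of [G(S)], and sorting each pair by index
    lets every edge count once. This bounds the input size by the number of edges. *)
Lemma arr_num_edges_ge : \sum_i (size (L i)).-1 <= arr_num_edges S c.
Proof.
have setT_inner i v : v \in L i -> v \notin [set: 'I_N] -> c v = (S i).1 \/ c v = (S i).2.
  by rewrite inE.
pose o : rel 'I_N := fun a b => a < b.
have sub_LT i : sub_L L [set: 'I_N] i = L i.
  by rewrite /sub_L (eq_filter (a2 := predT)) ?filter_predT // => v; rewrite inE.
under eq_bigr => i _ do rewrite -sub_LT.
rewrite -size_sub_pairs -(size_map (orient o)).
rewrite -(card_uniqP (uniq_orient_sub_pairs S_nondeg S_meet encL [set: 'I_N] o)).
apply: subset_leq_card; apply/subsetP=> p /mapP[[u v] uv ->]; rewrite inE.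
have [i [nb _]] := mem_sub_pairs S_nondeg encL uv.
have e := neighbours_arr_edge S_nondeg encL setT_inner nb.
have e' := neighbours_arr_edge S_nondeg encL setT_inner (neighbours_sym nb).
rewrite /orient /o /=; case: (ltngtP u v) => /= lt.
- by rewrite lt; apply/asboolP.
- by rewrite lt; apply/asboolP.
by have [_ _ /eqP ne _] := nb; case: ne; exact: val_inj.
Qed.

Lemma num_vertices_le : N <= \sum_i size (L i).
Proof.
rewrite -[X in X <= _]card_ord -sum1_card.
apply: (@leq_trans (\sum_(v : 'I_N) deg v)).
  apply: leq_sum => v _; rewrite card_gt0; apply/set0Pn.
  case: (c_vertex encL v) => [[i hi]|[i [_ [_ [hi _]]]]]; exists i; rewrite inE; apply/mem_L => //.
  by case: hi => ->; [exact: start_on_seg | exact: end_on_seg].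
have <- : \sum_i size (sub_L L [set: 'I_N] i) = \sum_(v : 'I_N) deg v.
  by rewrite sum_size_sub_L; apply: eq_bigl => v; rewrite inE.
by apply: leq_sum => i _; rewrite size_filter count_size.
Qed.


(** * Comparison with an arbitrary hitting set *)

Section OptimalSet.

Variable P : seq (point R).
Hypothesis P_uniq : uniq P.
Hypothesis P_hits : hits_all S P.

Let on x i : bool := `[< on_seg x (S i) >].

(** Points of a hitting set need not be vertices; two segments through such a point would make it
    one. *)
Lemma card_on_le1 x : (forall v, c v <> x) -> #|[set i | on x i]| <= 1.
Proof.
move=> nov; rewrite leqNgt; apply/negP=> /card_gt1P[i [j]]; rewrite !inE.
case=> /asboolP xi /asboolP xj ij; have [] := vertex_c encL (x := x).
  by right; exists i, j.
by move=> v /nov.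
Qed.

Lemma on_c v i : on (c v) i = (v \in L i).
Proof. by apply/asboolP/idP=> [/mem_L|/mem_L]. Qed.

Lemma card_le_sum (A : {set 'I_n}) (Q : seq (point R)) :
  (forall i, i \in A -> exists2 x, x \in Q & on x i) ->
  #|A| <= \sum_(x <- Q) #|[set i in A | on x i]|.
Proof.
move=> hA; rewrite -sum1_card.
have -> : \sum_(x <- Q) #|[set i in A | on x i]| = \sum_(i in A) \sum_(x <- Q) (on x i : nat).
  rewrite exchange_big /=; apply: eq_bigr => x _.
  rewrite -sum1_card big_mkcond [RHS]big_mkcond; apply: eq_bigr => i _.
  by rewrite inE; case: (i \in A) => //=; case: (on x i).
apply: leq_sum => i /hA[x xQ xi].
by rewrite (big_rem _ xQ) /= xi.
Qed.

Definition picked (s : seq nat) (x : point R) : bool := [exists v : 'I_N, (val v \in s) && (c v == x)].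

(** An unhit segment is hit by a point of [P] not picked in [s]. Such a point accounts for at most
    [b] unhit segments if it is a vertex, and for at most [1 <= b] otherwise. *)
Lemma nunhit_le s out b : 0 < b -> {subset s <= out} ->
  (forall v, v < N -> residual Ls out v <= b) ->
  nunhit Ls out <= b * count (predC (picked s)) P.
Proof.
move=> b0 sub res; rewrite nunhitE -size_filter.
apply: leq_trans (card_le_sum (Q := [seq x <- P | predC (picked s) x]) _) _.
  move=> i; rewrite inE => ui; have [x [xP xi]] := P_hits i.
  exists x; last exact/asboolP.
  rewrite mem_filter xP andbT; apply: contra ui => /existsP[v /andP[vs /eqP vx]].
  apply/hasP; exists (val v); first exact: sub.
  by rewrite mem_adj_ord; apply/mem_L; rewrite vx.
rewrite -sum_const_seq; apply: leq_sum => x _.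
have [[v <-]|nov] := pselect (exists v, c v = x).
  apply: leq_trans (res v (ltn_ord v)); rewrite residualE.
  by apply: subset_leq_card; apply/subsetP=> i; rewrite !inE on_c.
apply: leq_trans b0; apply: leq_trans (card_on_le1 (x := x) _); last by move=> v vx; apply: nov; exists v.
by apply: subset_leq_card; apply/subsetP=> i; rewrite !inE => /andP[].
Qed.

(** As [P] hits everything, [n] is at most [2 * size P] plus the excess [deg v - 2] of the crossings
    in [P]. Subtracting that excess from [sum_crossings] leaves the crossings outside [P]. *)
Lemma sum_outside : \sum_(v in crossings | c v \notin P) (deg v - 2) <= 2 * size P.
Proof.
have hn : n <= \sum_(x <- P) #|[set i in [set: 'I_n] | on x i]|.
  rewrite -[X in X <= _]card_ord -cardsT; apply: card_le_sum => i _.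
  by have [x [xP xi]] := P_hits i; exists x => //; apply/asboolP.
have hx : \sum_(x <- P) #|[set i in [set: 'I_n] | on x i]|
    <= \sum_(x <- P) (2 + \sum_(v in crossings | c v == x) (deg v - 2)).
  apply: leq_sum => x _; have [[v vx]|nov] := pselect (exists v, c v = x).
    have -> : #|[set i in [set: 'I_n] | on x i]| = deg v.
      by apply: eq_card => i; rewrite !inE -vx on_c.
    have [vc|] := boolP (v \in crossings).
      rewrite (bigD1 v) /= ?vc ?vx ?eqxx // addnA.
      by apply: leq_trans (leq_addr _ _); lia.
    by rewrite inE -leqNgt => dv; apply: leq_trans dv (leq_addr _ _).
  apply: (@leq_trans 1); last by [].
  apply: leq_trans (card_on_le1 (x := x) _); last by move=> v vx; apply: nov; exists v.
  by apply: subset_leq_card; apply/subsetP=> i; rewrite !inE.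
have hs : \sum_(x <- P) (2 + \sum_(v in crossings | c v == x) (deg v - 2))
    = size P * 2 + \sum_(v in crossings | c v \in P) (deg v - 2).
  rewrite big_split /= sum_const_seq mulnC; congr (_ + _).
  rewrite (eq_bigr (fun x => \sum_(v in crossings) (c v == x) * (deg v - 2))); last first.
    by move=> x _; rewrite big_mkcondr; apply: eq_bigr => v _; case: (c v == x); rewrite ?mul1n ?mul0n.
  rewrite exchange_big big_mkcondr /=; apply: eq_bigr => v _.
  rewrite -big_distrl /=.
  have -> : \sum_(x <- P) (c v == x : nat) = (c v \in P).
    rewrite -(count_uniq_mem _ P_uniq) -sum1_count [RHS]big_mkcond.
    by apply: eq_bigr => x _; rewrite /= eq_sym; case: (_ == _).
  by case: (c v \in P); rewrite ?mul1n ?mul0n.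
have hc := sum_crossings; rewrite (bigID (fun v => c v \in P)) /= in hc.
move: hc hn hx; rewrite hs.
set a := \sum_(v in _ | c v \in P) _; set b := \sum_(v in _ | c v \notin P) _.
by set w := \sum_(x <- P) _; clearbody a b w; lia.
Qed.

Lemma greedy_ratio : size (greedy N Ls) <= 3 * size P.
Proof.
rewrite /greedy.
have [s4 [-> sub4 u4 d4 r4]] := greedy_phase_spec N Ls_uniq [::] (isT : 0 < 4).
have [s2 [-> sub2 u2 d2 r2]] := greedy_phase_spec N Ls_uniq ([::] ++ s4) (isT : 0 < 2).
have [s1 [-> sub1 u1 d1 r1]] := greedy_phase_spec N Ls_uniq (([::] ++ s4) ++ s2) (isT : 0 < 1).
rewrite /= in u2 r2 u1 r4 u4 *.
have s4_uniq : uniq s4 by apply: subseq_uniq sub4 (iota_uniq _ _).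
have s4_lt v : v \in s4 -> v < N by move=> /(mem_subseq sub4); rewrite mem_iota.
pose A := [set v : 'I_N | val v \in s4].
have cardA : #|A| = size s4.
  rewrite cardE -(size_map val); apply/perm_size/uniq_perm => //.
    by rewrite map_inj_uniq ?enum_uniq //; exact: val_inj.
  move=> k; apply/mapP/idP=> [[v]|ks]; first by rewrite mem_enum inE => vs ->.
  by exists (Ordinal (s4_lt _ ks)); rewrite // mem_enum inE.
have A_deg v : v \in A -> 4 <= deg v by rewrite inE -size_adj => /d4.
have h3 : nunhit Ls s4 <= 3 * count (predC (picked s4)) P.
  by apply: nunhit_le => // v /r4.
have h1 : nunhit Ls (s4 ++ s2) <= 1 * count (predC (picked s4)) P.
  by apply: nunhit_le => // v; rewrite mem_cat => ->.
(* A vertex of the first pass has degree at least 4, so outside [P] it contributes at least 2 to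
   [sum_outside]. *)
have hout : 2 * #|[set v in A | c v \notin P]| <= 2 * size P.
  apply: leq_trans sum_outside; rewrite mulnC -sum_nat_const.
  rewrite big_mkcond [X in _ <= X]big_mkcond; apply: leq_sum => v _; rewrite !inE.
  case: (boolP (val v \in s4)) => //= vs; have dv : 4 <= deg v by apply: A_deg; rewrite inE.
  by rewrite (ltn_trans _ dv) //=; case: (c v \in P) => //=; lia.
have hin : #|[set v in A | c v \in P]| + count (predC (picked s4)) P <= size P.
  rewrite -(count_predC (picked s4) P) leq_add2r -size_filter cardE -(size_map c).
  apply: uniq_leq_size; first by rewrite map_inj_uniq ?enum_uniq.
  move=> x /mapP[v]; rewrite mem_enum !inE => /andP[vs vP] ->.
  by rewrite mem_filter vP andbT; apply/existsP; exists v; rewrite vs eqxx.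
have hA : #|A| = #|[set v in A | c v \in P]| + #|[set v in A | c v \notin P]|.
  rewrite -(cardsID [set v | c v \in P] A); congr (_ + _); apply: eq_card => v.
    by rewrite !inE.
  by rewrite !inE andbC.
(* If [k] points of [P] are missed by the first pass, then [2 * size s2 + size s1 <= 3 * k] and
   [size s1 <= k], so the last two passes make at most [2 * k] picks. The first makes at most
   [size P - k] inside [P] and [size P] outside. *)
by rewrite !size_cat; move: hA h3 h1 hout hin u2 u1; rewrite cardA; lia.
Qed.

End OptimalSet.

Lemma greedy_lt v : v \in greedy N Ls -> v < N.
Proof.
rewrite /greedy.
have [s4 [-> sub4 _ _ _]] := greedy_phase_spec N Ls_uniq [::] (isT : 0 < 4).
have [s2 [-> sub2 _ _ _]] := greedy_phase_spec N Ls_uniq ([::] ++ s4) (isT : 0 < 2).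
have [s1 [-> sub1 _ _ _]] := greedy_phase_spec N Ls_uniq (([::] ++ s4) ++ s2) (isT : 0 < 1).
rewrite !mem_cat in_nil /= => /orP[/orP[/(mem_subseq sub4)|/(mem_subseq sub2)]|/(mem_subseq sub1)];
by rewrite mem_iota.
Qed.

(** After the pass with threshold 1 every vertex has residual 0, and every segment carries a
    vertex. *)
Lemma greedy_hits i : exists v : 'I_N, val v \in greedy N Ls /\ on_seg (c v) (S i).
Proof.
have [s1 [E1 _ _ _ r1]] := greedy_phase_spec N Ls_uniq
  (greedy_phase N Ls 2 (greedy_phase N Ls 4 [::])) (isT : 0 < 1).
have [v vL] : exists v, v \in L i.
  by case: (L i) (two_le_size_L i) => // v s _; exists v; rewrite mem_head.
have : hit Ls (greedy N Ls) i.
  have := r1 v (ltn_ord v); rewrite -E1 ltnS leqn0 => /eqP r0.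
  move: r0; rewrite -/(greedy N Ls) residualE => /eqP; rewrite cards_eq0 => /eqP/setP/(_ i).
  by rewrite !inE vL andbT => /negbFE.
case/hasP=> w wout iw.
have wN : w < N by apply: greedy_lt wout.
exists (Ordinal wN); split=> //; apply/mem_L.
by rewrite -mem_adj_ord.
Qed.

(** For [m] edges, [n <= m]; the lists have total length at most [2 * m], each having two or more
    entries; and [N] is at most that length. The sum is at most [5 * m + 1]. *)
Lemma input_size_le :
  1 + N + size Ls + \sum_(l <- Ls) size l <= 5 * (arr_num_edges S c).+1.
Proof.
rewrite sum_size_Ls size_Ls; have h1 := num_vertices_le; have h2 := arr_num_edges_ge.
have h3 : \sum_i size (L i) <= \sum_i 2 * (size (L i)).-1.
  by apply: leq_sum => i _; have := two_le_size_L i; lia.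
have h4 : n <= \sum_i (size (L i)).-1.
  rewrite -[X in X <= _]card_ord -sum1_card; apply: leq_sum => i _.
  by have := two_le_size_L i; lia.
rewrite -big_distrr /= in h3.
move: h1 h2 h3 h4; move: (\sum_i size _) (\sum_i (size _).-1) (arr_num_edges _ _) => a b d.
by move=> *; lia.
Qed.

End Approximation.


(** Program and constant are chosen before the field and the arrangement, so one machine serves all
    inputs. The successor in the time bound covers the constant cost of an empty arrangement. *)
Theorem mainTheorem18 :
  exists (prog : seq instr) (C : nat),
  forall (R : realType) (n : nat) (S : 'I_n -> segment R),
    segs_nondegenerate S ->
    pairwise_at_most_one_point S ->
    arr_triangle_free S ->
    forall (N : nat) (c : 'I_N -> point R) (L : 'I_n -> seq 'I_N),
      valid_encoding S c L ->
      exists t : nat,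
        let cf := run prog t (init_config (encode L)) in
        [/\ (t <= C * (arr_num_edges S c).+1)%N,
            halted prog cf,
            (forall k, k \in output (cf_mem cf) -> (k < N)%N),
            (forall i, exists v : 'I_N,
                 val v \in output (cf_mem cf) /\ on_seg (c v) (S i)) &
            (forall P : seq (point R), uniq P -> hits_all S P ->
                 (size (undup (output (cf_mem cf))) <= 3 * size P)%N)].
Proof.
have [prog [C hprog]] := greedy_program_runs.
exists prog, (5 * C) => R n S nd meet tri N c L enc.
have [t [ht halt out]] := hprog N _ (Ls_lt L) (Ls_uniq enc).
exists t; rewrite encodeE /= out; split=> //.
- apply: leq_trans ht _; rewrite mulnAC mulnC leq_mul2r.
  by rewrite (input_size_le nd meet enc) orbT.
- by move=> k; exact: (greedy_lt enc).
- exact: (greedy_hits nd enc).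
- move=> P uP hP; apply: leq_trans (size_undup _) _.
  exact: (greedy_ratio nd meet tri enc uP hP).
Qed.
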